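(* Let $S$ be a countable (infinite) set with rates $c_{x,y}\in[0,+\infty)$, $x\ne y$ in $S$ (not necessarily symmetric), satisfying Assumption SEP. Then local functions belong to the domain $\mathcal D(\mathcal L)$ of the infinitesimal generator $\mathcal L$ of the simple exclusion process with rates $c_{x,y}$. Moreover, for any local function $f$, $$\mathcal L f(\eta)=\sum_{x\in S}\sum_{y\in S}c_{x,y}\,\eta(x)\big(1-\eta(y)\big)\big[f(\eta^{x,y})-f(\eta)\big],\qquad\eta\in\{0,1\}^S.$$ The series in the right-hand side is an absolutely convergent series of functions in $C(\{0,1\}^S)$.
   Context: Setting. $S$ is a countable (infinite) set; $\mathcal E_S^o:=\{(x,y):x\ne y,\ x,y\in S\}$ (ordered pairs), $\mathcal E_S:=\{\{x,y\}:x\neq y,\ x,y\in S\}$ (unordered pairs). To each $(x,y)\in\mathcal E_S^o$ is associated $c_{x,y}\in[0,+\infty)$, not assumed symmetric; $c_{x,x}:=0$; $c^s_{x,y}:=c_{x,y}+c_{y,x}$. Path spaces. For a metric space $W$, $D_W=D(\mathbb R_+,W)$ is the space of càdlàg paths $\mathbb R_+=[0,+\infty)\to W$ with the Skorohod topology and its Borel $\sigma$-algebra. $\mathbb N=\{0,1,\dots\}$ is discrete; $\{0,1\}^S$ has the product topology. $D_{\mathbb N}^{\mathcal E_S^o}$ has the product topology, with generic element $\mathcal K=(\mathcal K_{x,y})_{(x,y)\in\mathcal E_S^o}$. $\mathbb P$ (with expectation $\mathbb E$) is the law on $D_{\mathbb N}^{\mathcal E_S^o}$ of a family $(N_{x,y}(\cdot))_{(x,y)\in\mathcal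 E_S^o}$ of independent Poisson processes, $N_{x,y}$ having intensity $c_{x,y}$ and $N_{x,y}(0)=0$. For $\{x,y\}\in\mathcal E_S$, $\mathcal K^s_{x,y}(t):=\mathcal K_{x,y}(t)+\mathcal K_{y,x}(t)$. Assumption SEP: there exists $t_0>0$ such that for $\mathbb P$-a.a. $\mathcal K$ the undirected graph $\mathcal G_{t_0}(\mathcal K)$ with vertex set $S$ and edge set $\{\{x,y\}\in\mathcal E_S:\mathcal K^s_{x,y}(t_0)>\mathcal K^s_{x,y}(0)\}$ has only connected components of finite cardinality. Such a $t_0$ is fixed. For $r\in\mathbb N$, $\mathcal G^r_{t_0}(\mathcal K)$ is the graph with vertex set $S$ and edge set $\{\{x,y\}\in\mathcal E_S:\mathcal K^s_{x,y}((r+1)t_0)>\mathcal K^s_{x,y}(rt_0)\}$, and $\Gamma_r$ is the set of $\mathcal K$ for which $\mathcal G^r_{t_0}(\mathcal K)$ has only finite connected components. $\Gamma_*$ is the set of $\mathcal K\in D_{\mathbb N}^{\mathcal E_S^o}$ such that: (i) $\mathcal K\in\cap_{r\in\mathbb N}\Gamma_r$; (ii) $\sum_{y\in S\setminus\{x\}}\mathcal K^s_{x,y}(t)<+\infty$ for all $x\in S$, $t\in\mathbb R_+$; (iii) for $(x,y)\ne(x',y')$ in $\mathcal E^o_S$ the sets of jump times of $\mathcal K_{x,y}$ and $\mathcal K_{x',y'}$ are disjoint, and all jumps equal $+1$; (iv) $\mathcal K_{x,y}(0)=0$ for all $(x,y)\in\mathcal E^o_S$. $\Gamma_*$ is Borel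 and $\mathbb P(\Gamma_* )=1$. Graphical construction. For $\mathcal K\in\Gamma_*$ and $\sigma\in\{0,1\}^S$ define $(\eta^\sigma_t[\mathcal K])_{t\ge0}$ iteratively: $\eta^\sigma_0[\mathcal K]:=\sigma$. If defined up to time $rt_0$, $r\in\mathbb N$, for each (finite) connected component $C$ of $\mathcal G^r_{t_0}(\mathcal K)$ let $s_1<\dots<s_k$ be the times $s\in(rt_0,(r+1)t_0]$ at which $\mathcal K_{x,y}(s)=\mathcal K_{x,y}(s-)+1$ for some $x\neq y$ in $C$. On $C$, start from $\eta^\sigma_{rt_0}[\mathcal K]$ and, successively at $s=s_1,\dots,s_k$, move a particle from $x$ to $y$ ($x\ne y$ in $C$) if just before time $s$ site $x$ is occupied and $y$ is empty, and $\mathcal K_{x,y}(s)=\mathcal K_{x,y}(s-)+1$ (at most one such pair exists); between these times the configuration on $C$ is constant. This defines $\eta^\sigma_t[\mathcal K]$ for $t\in(rt_0,(r+1)t_0]$. Semigroup and generator. $C(\{0,1\}^S)$ is the space of real continuous functions with the uniform norm. $S(t)f(\sigma):=\mathbb E[f(\eta^\sigma_t[\mathcal K])]$ defines a strongly continuous Markov semigroup on $C(\{0,1\}^S)$, the semigroup of the simple exclusion process (SEP) with rates $c_{x,y}$. Its generator $\mathcal L$ has domain $\mathcal D(\mathcal L)=\{f\in C(\{0,1\}^S): \lim_{t\downarrow0}(S(t)f-f)/t\text{ exists in }C(\{0,1\}^S)\}$ and $\mathcal L f$ is that limit. $\eta^{x,y}$ is obtained from $\eta$ by exchanging the values at $x$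 and $y$. A function $f:\{0,1\}^S\to\mathbb R$ is local if for some finite $A\subset S$, $f(\eta)$ is determined by $(\eta(x))_{x\in A}$. Absolutely convergent series in $C(\{0,1\}^S)$: the sum of the uniform norms of the terms is finite. *)

(* Defs.v *)
From HB Require Import structures.
From mathcomp Require Import all_boot all_order all_algebra finmap.
From mathcomp Require Import all_classical all_reals all_analysis.
From mathcomp Require showcase.summability.

Set Implicit Arguments.
Unset Strict Implicit.
Unset Printing Implicit Defensive.

Import Order.TTheory GRing.Theory Num.Theory.
Import numFieldNormedType.Exports.

Local Open Scope classical_set_scope.
Local Open Scope ring_scope.

(* A path on R_+ is represented by a function on R that is constant on
   ]-oo, 0]; this makes the representation unique. *)
Record cadlag (R : realType) := Cadlag {
  cadlag_fun :> R -> nat ;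
  cadlag_neg : forall t, t <= 0 -> cadlag_fun t = cadlag_fun 0 ;
  cadlag_right : forall t, 0 <= t ->
    cadlag_fun s @[s --> t^'+] --> cadlag_fun t ;
  cadlag_left : forall t, 0 < t -> cvg (cadlag_fun s @[s --> t^'-]) }.

Section cadlag_choice_pointed.
Variable R : realType.

HB.instance Definition _ := gen_eqMixin (cadlag R).
HB.instance Definition _ := gen_choiceMixin (cadlag R).

Let cst0_neg (t : R) : t <= 0 -> (cst 0%N : R -> nat) t = cst 0%N (0 : R).
Proof. by []. Qed.

Let cst0_right (t : R) : 0 <= t ->
  (cst 0%N : R -> nat) s @[s --> t^'+] --> (cst 0%N : R -> nat) t.
Proof. by move=> _; exact: cvg_cst. Qed.

Let cst0_left (t : R) : 0 < t -> cvg ((cst 0%N : R -> nat) s @[s --> t^'-]).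
Proof. by move=> _; exact: is_cvg_cst. Qed.

HB.instance Definition _ :=
  isPointed.Build (cadlag R) (Cadlag cst0_neg cst0_right cst0_left).

End cadlag_choice_pointed.

Section skorohod.
Variable R : realType.
Implicit Types (x y : cadlag R) (T e : R).

Definition time_change (lam : R -> R) :=
  (forall s t, 0 <= s -> s < t -> lam s < lam t) /\
  lam @` [set t | 0 <= t] = [set t | 0 <= t].

(* x_n --> x in the Skorohod topology iff, for all T and e > 0, x_n is
   eventually in skorohod_ball x T e (Ethier and Kurtz, Markov Processes,
   Proposition 3.5.3 (c)). As N is discrete, uniform closeness of the values
   up to time T is equality. *)
Definition skorohod_ball x T e : set (cadlag R) := [set y |
  exists2 lam, time_change lam &
    forall s, 0 <= s <= T -> `|lam s - s| < e /\ y s = x (lam s)].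

Definition skorohod_open : set_system (cadlag R) := [set A |
  forall x, A x -> exists T e, 0 < e /\ skorohod_ball x T e `<=` A].

Let skorohod_openT : skorohod_open setT.
Proof. by move=> x _; exists 0, 1; split. Qed.

Let skorohod_openI : setI_closed skorohod_open.
Proof.
move=> A B oA oB x [/oA[T [e [e0 sA]]] /oB[T' [e' [e0' sB]]]].
exists (Num.max T T'), (Num.min e e'); split; first by rewrite lt_min e0.
move=> y [lam tc H]; split; [apply: sA|apply: sB]; exists lam => // s /andP[s0 sT].
  have [|] := H s; first by rewrite s0 le_max sT.
  by rewrite lt_min => /andP[].
have [|] := H s; first by rewrite s0 le_max sT orbT.
by rewrite lt_min => /andP[].
Qed.

Let skorohod_open_bigU (I : Type) (f : I -> set (cadlag R)) :
  (forall i, skorohod_open (f i)) -> skorohod_open (\bigcup_i f i).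
Proof.
move=> of_ x [i _ /(of_ i)[T [e [e0 s]]]]; exists T, e; split => // y /s fy.
by exists i.
Qed.

HB.instance Definition _ := isOpenTopological.Build (cadlag R)
  skorohod_openT skorohod_openI skorohod_open_bigU.

End skorohod.

Definition oedge (S : countType) := {p : S * S | p.1 != p.2}.
HB.instance Definition _ (S : countType) := Countable.on (oedge S).

Definition path_family (R : realType) (S : countType) :=
  prod_topology (fun _ : oedge S => cadlag R).
HB.instance Definition _ (R : realType) (S : countType) :=
  Topological.on (path_family R S).
HB.instance Definition _ (R : realType) (S : countType) :=
  isPointed.Build (path_family R S) (fun _ => point).

Notation borel T := (g_sigma_algebraType (@open T)).

Definition mutually_independent (R : realType) (d d' : measure_display)
    (T : measurableType d) (U : measurableType d') (P : probability T R)
    (I : choiceType) (X : I -> T -> U) :=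
  forall (J : {fset I}) (A : I -> set U), (forall i, measurable (A i)) ->
    P (\bigcap_(i in [set` J]) (X i @^-1` A i)) =
    (\prod_(i <- J) P (X i @^-1` A i))%E.

(* The second argument of poisson_prob is a dummy; poisson_prob 0 is the Dirac
   mass at 0. *)
Definition poisson_process (R : realType) (d : measure_display)
    (T : measurableType d) (P : probability T R) (N : T -> R -> nat)
    (rate : R) :=
  [/\ {ae P, forall w, N w 0 = 0%N},
      forall s t n, 0 <= s -> s <= t ->
        P [set w | N w t = (N w s + n)%N] =
        poisson_prob (rate * (t - s)) 0%N [set n]
    & forall t : nat -> R, 0 <= t 0%N -> {homo t : i j / (i <= j)%N >-> i <= j} ->
        mutually_independent (U := measurableTypeR R) P
          (fun i w => (N w (t i.+1))%:R - (N w (t i))%:R)].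

Definition poisson_law (R : realType) (S : countType) (c : S -> S -> R)
    (P : probability (borel (path_family R S)) R) :=
  (forall e : oedge S,
     poisson_process P (fun K : path_family R S => K e)
       (c (val e).1 (val e).2)) /\
  mutually_independent (U := borel (cadlag R)) P
    (fun (e : oedge S) (K : path_family R S) => K e).

Section graphs.
Variables (R : realType) (S : countType).
Implicit Types (K : path_family R S) (x y : S) (t : R).

Definition Kpath K x y : R -> nat :=
  if insub (x, y) is Some e then K e else cst 0%N.

Definition Ksym K x y t : nat := (Kpath K x y t + Kpath K y x t)%N.

Definition jump_graph K (a b : R) : rel S :=
  fun x y => (Ksym K x y a < Ksym K x y b)%N.

Definition component (e : rel S) x : set S :=
  [set y | exists2 p, path e x p & y = last x p].

Definition finite_components (e : rel S) :=
  forall x, finite_set (component e x).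

Definition assumption_SEP (P : probability (borel (path_family R S)) R)
    (t0 : R) :=
  0 < t0 /\
  {ae P, forall K : path_family R S, finite_components (jump_graph K 0 t0)}.

Definition step_graph (t0 : R) K (r : nat) : rel S :=
  jump_graph K (r%:R * t0) (r.+1%:R * t0).

Definition left_lim (f : R -> nat) t : nat := lim (f s @[s --> t^'-]).

Definition jump_times (f : R -> nat) : set R :=
  [set t | 0 < t /\ f t <> left_lim f t].

Definition Gamma_star (t0 : R) : set (path_family R S) := [set K |
  [/\ forall r : nat, finite_components (step_graph t0 K r),
      forall x t, 0 <= t ->
        (\esum_(y in [set y | y != x]) (Ksym K x y t)%:R%:E < +oo :> \bar R)%E,
      forall e e' : oedge S, e != e' ->
        jump_times (K e) `&` jump_times (K e') = set0,
      forall (e : oedge S) t, jump_times (K e) t ->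
        K e t = (left_lim (K e) t).+1
    & forall e : oedge S, K e 0 = 0%N]].

End graphs.

Definition config (S : countType) := prod_topology (fun _ : S => bool).
HB.instance Definition _ (S : countType) := Topological.on (config S).

Section graphical_construction.
Variables (R : realType) (S : countType) (t0 : R) (K : path_family R S).
Implicit Types (x y z : S) (C : set S) (s t a b : R) (xi : config S).

Definition unit_jump x y s := Kpath K x y s = (left_lim (Kpath K x y) s).+1.

Definition event_times C a b : set R := [set s | a < s <= b /\
  exists x y, [/\ C x, C y, x != y & unit_jump x y s]].

Definition moves C s xi x y :=
  [/\ C x, C y & x != y] /\ [/\ xi x, ~~ xi y & unit_jump x y s].

Definition exclusion_step C xi s : config S := fun z =>
  if `[< exists y, moves C s xi z y >] then false
  else if `[< exists x, moves C s xi x z >] then true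
  else xi z.

(* xi is the configuration at time r t0, and r t0 <= t <= (r + 1) t0.
   event_times is finite for K in Gamma_star, the only K for which evolve is
   used (fset_set of an infinite set is empty). *)
Definition evolve (r : nat) xi t : config S := fun x =>
  let C := component (step_graph t0 K r) x in
  foldl (exclusion_step C) xi
    (sort <=%R (fset_set (event_times C (r%:R * t0) t))) x.

Fixpoint eta_grid (sigma : config S) (r : nat) : config S :=
  if r is r'.+1 then evolve r' (eta_grid sigma r') (r%:R * t0) else sigma.

(* Here r t0 <= t < (r + 1) t0; for t = r t0 there are no event times in
   ]r t0, t], so that this is eta_grid sigma r. *)
Definition eta (sigma : config S) t : config S :=
  let r := Num.truncn (t / t0) in evolve r (eta_grid sigma r) t.

End graphical_construction.

Section generator.
Variables (R : realType) (S : countType).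
Variables (P : probability (borel (path_family R S)) R) (t0 : R).
Implicit Types f g : config S -> R.

Definition semigroup (t : R) f (sigma : config S) : R :=
  \int[P]_(K in Gamma_star t0) f (eta t0 K sigma t).

Definition uniform_norm f : \bar R :=
  ereal_sup [set `|f xi|%:E | xi in [set: config S]].

Definition generator_graph f g :=
  [/\ continuous f, continuous g &
    uniform_norm (fun sigma => (semigroup t f sigma - f sigma) / t - g sigma)
      @[t --> 0^'+] --> 0%E].

Definition generator_domain : set (config S -> R) :=
  [set f | exists g, generator_graph f g].

(* The default value (cst 0) is irrelevant: it is only taken outside the
   domain. *)
Definition generator f : config S -> R :=
  xget (cst 0) [set g | generator_graph f g].

End generator.

Definition local_function (R : realType) (S : countType) (f : config S -> R) :=
  exists A : {fset S}, forall xi zeta : config S,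
    {in A, xi =1 zeta} -> f xi = f zeta.

Definition exchange (S : countType) (xi : config S) (x y : S) : config S :=
  fun z => if z == x then xi y else if z == y then xi x else xi z.

Definition generator_term (R : realType) (S : countType) (c : S -> S -> R)
    (f : config S -> R) (x y : S) (xi : config S) : R :=
  c x y * (xi x)%:R * (1 - (xi y)%:R) * (f (exchange xi x y) - f xi).

(* summability.sum is the limit of the finite partial sums along the directed
   set of the finite subsets of I. *)
Definition series_sum (R : realType) (I : choiceType) (F : I -> R) : R :=
  summability.sum (F : I -> R^o).

(* Main.v *)
Require Import Defs.
From mathcomp Require Import all_boot all_order all_algebra finmap.
From mathcomp Require Import all_classical all_reals all_analysis.
From mathcomp Require Import measurable_realfun.
From mathcomp Require Import ring lra zify.
From mathcomp Require summability.

Set Implicit Arguments.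
Unset Strict Implicit.
Unset Printing Implicit Defensive.

Import Order.TTheory GRing.Theory Num.Theory.
Import numFieldNormedType.Exports.

Local Open Scope classical_set_scope.
Local Open Scope ring_scope.

(** The generator is computed from a first-order expansion of the graphical construction
    at small times. Let [f] depend on the sites of a finite set [A] only, and let [t] be
    smaller than [t0], so that a single time step is involved. If no edge that meets [A]
    jumps before time [t], then [f] keeps its value. If exactly one such edge [(x, y)]
    jumps, once, and no other edge at [x] or [y] does, then the configuration on [A] is
    the initial one with a particle moved from [x] to [y] when the exclusion rule allows
    it ([one_jump_expansion]). The first jump has probability [c x y * t + O(t ^ 2)] and
    changes [f] by the corresponding term of the generator, which gives the derivative at
    time 0; all remaining events must have probability [o(t)], uniformly in the initial
    configuration.

    The uniformity is the delicate point. The total rate of the edges that meet [A] is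
    finite: otherwise, by independence, infinitely many edges at some site would jump
    before [t0], and its component would be infinite ([rate_sum_finite]). But the total
    rates at the neighbours of [A] may be unbounded. So, given [eps], a finite set [F] of
    edges is chosen such that the other edges that meet [A] have total rate at most [eps].
    With probability at least [1 - eps * t] none of these jumps, and since [F] is finite,
    the probability that a jump in [F] is accompanied by an interfering jump is at most
    [C * t ^ 2] with a constant that depends on [F] ([far_jump_prob],
    [double_jump_prob]). Hence the difference quotient is within a multiple of
    [eps + C * t] of the generator ([semigroup_estimate]), and [eps] is arbitrary. The
    same finite sets show that the series of the generator is an absolutely convergent
    series of continuous functions ([exclusion_generator_approx], [term_bound_tail]).

    The expectation defining the semigroup is an integral over [Gamma_star t0], which has
    to be shown to have full measure ([Gamma_star_ae]). The paths are nondecreasing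
    because Poisson increments are natural numbers ([regular_ae]); unit jumps and the
    absence of simultaneous jumps follow from estimates of increments over small time
    intervals ([ae_no_time_in_rare_intervals]); finiteness of the components during the
    later time steps follows from that of the first one, because the set of edges that
    jump during a step has the same law for all steps ([jump_pattern_stationary]).
    Finally, the integrand is compared with a combination of indicators of jump events
    from which it differs on a small event only; such a comparison of integrals holds for
    arbitrary bounded functions ([Rintegral_perturb]). *)

(** * Finite sets of countable types *)

Lemma finite_set_inj (I J : Type) (A : set I) (B : set J) (f : I -> J) :
  finite_set B -> (forall i, A i -> B (f i)) ->
  (forall i j, A i -> A j -> f i = f j -> i = j) -> finite_set A.
Proof.
move=> Bfin AB finj.
rewrite -(eq_finite_set (inj_card_eq (f := f) _)).
  by apply: sub_finite_set Bfin => _ [i Ai <-]; exact: AB.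
by move=> i j; rewrite !inE; exact: finj.
Qed.

Lemma finite_set_pickle (I : countType) (A : set I) :
  finite_set A <-> exists n, forall i, A i -> (choice.pickle i < n)%N.
Proof.
split=> [Afin|[n An]].
  exists (\max_(i <- fset_set A) (choice.pickle i).+1)%N => i Ai.
  have iA : i \in fset_set A by rewrite in_fset_set// mem_set.
  exact: (@leq_bigmax_seq _ _ xpredT (fun i => (choice.pickle i).+1) _ iA isT).
apply: (finite_set_inj (finite_II n) An) => i j _ _.
exact: (pcan_inj choice.pickleK).
Qed.

(** * Nondecreasing cadlag paths *)

Section cadlag_paths.
Variable R : realType.
Implicit Types (x : cadlag R) (s t : R).

Lemma cadlag_right_cst x t : 0 <= t ->
  exists2 d : R, 0 < d & forall s, t <= s < t + d -> x s = x t.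
Proof.
move=> t0; have /(_ [set m | m = x t]) := cadlag_right (c := x) t0.
case=> [|d /= d0 H]; first by [].
exists d => // s /andP[]; rewrite le_eqVlt => /predU1P[<-//|ts std].
by apply: H => //=; rewrite ltr_distlC; apply/andP; split; lra.
Qed.

Lemma cadlag_left_cst x t : 0 < t ->
  exists2 d : R, 0 < d & forall s, t - d < s < t -> x s = left_lim x t.
Proof.
move=> t0; have /(_ [set m | m = left_lim x t]) := cadlag_left (c := x) t0.
case=> [|d /= d0 H]; first by [].
exists d => // s /andP[tds st].
by apply: H => //=; rewrite ltr_distlC; apply/andP; split; lra.
Qed.

(** Constancy on a neighbourhood of a compact time interval survives small time
    changes, which pointwise values do not. *)
Definition constant_around (n : nat) (a b : R) : set (cadlag R) :=
  [set x | exists2 d : R, 0 < d & forall s, a - d < s < b + d -> x s = n].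

Lemma open_constant_around n a b : 0 < a -> open (constant_around n a b).
Proof.
move=> a0; change (skorohod_open (constant_around n a b)) => x [d d0 xn].
pose e := Num.min d a / 2.
have e0 : 0 < e by rewrite divr_gt0// lt_min d0.
have [ed ea] : e <= d / 2 /\ e <= a / 2.
  by split; rewrite ler_pM2r// ?invr_gt0// ge_min lexx ?orbT.
exists (b + d), e; split=> // y [lam _ H].
exists e => // s /andP[as1 sb].
have [|] := H s; first by apply/andP; split; lra.
rewrite ltr_distlC => /andP[s1 s2 ->]; apply: xn.
by apply/andP; split; lra.
Qed.

(** By right-continuity, the value at [t] is [n] iff the path equals [n] on some
    interval just after [t]; this is a countable combination of open conditions. *)
Lemma measurable_eval (t : R) (n : nat) : 0 <= t ->
  measurable ([set x | x t = n] : set (borel (cadlag R))).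
Proof.
move=> t0.
have -> : ([set x | x t = n] : set (borel (cadlag R))) =
  \bigcup_k \bigcap_j (constant_around n
     (t + k.+1%:R^-1 / j.+1%:R) (t + k.+1%:R^-1)).
  apply/seteqP; split=> x /=.
  - move=> xt; have [d d0 xd] := cadlag_right_cst x t0.
    have [k _ /(_ k (leqnn k))] := near_infty_natSinv_lt (PosNum d0).
    rewrite /= => kd; exists k => // j _.
    have k0 : 0 < k.+1%:R^-1 :> R by rewrite invr_gt0.
    have j0 : 0 < k.+1%:R^-1 / j.+1%:R :> R by rewrite divr_gt0.
    exists (Num.min (d - k.+1%:R^-1) (k.+1%:R^-1 / j.+1%:R)).
      by rewrite lt_min j0 andbT subr_gt0.
    move=> s; set m := Num.min _ _ => /andP[s1 s2].
    have m1 : m <= d - k.+1%:R^-1 by rewrite ge_min lexx.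
    have m2 : m <= k.+1%:R^-1 / j.+1%:R by rewrite ge_min lexx orbT.
    move: s1 s2 m1 m2 k0 j0; set a := k.+1%:R^-1; set b := a / _ => s1 s2 m1 m2 k0 j0.
    by rewrite xd//; apply/andP; split; lra.
  - case=> k _ H; have [d d0 xd] := cadlag_right_cst x t0.
    have k0 : 0 < k.+1%:R^-1 :> R by rewrite invr_gt0.
    have [j _ /(_ j (leqnn j))] := near_infty_natSinv_lt (PosNum (mulr_gt0 d0 (ltr0Sn R k))).
    rewrite /= => jd; have [e e0 xe] := H j I.
    have j1 : k.+1%:R^-1 / j.+1%:R < d by rewrite mulrC ltr_pdivrMr.
    have j2 : k.+1%:R^-1 / j.+1%:R <= k.+1%:R^-1 :> R.
      by rewrite ler_piMr ?invr_ge0// invf_le1// ler1n.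
    have j0 : 0 < k.+1%:R^-1 / j.+1%:R :> R by rewrite divr_gt0.
    rewrite -(xd (t + k.+1%:R^-1 / j.+1%:R)); last by rewrite lerDl ltW//= ltrD2l.
    rewrite xe//; move: j1 j2 k0 j0; set a := k.+1%:R^-1; set b := a / _ => *.
    by apply/andP; split; lra.
apply: bigcup_measurable => k _; apply: bigcapT_measurable => j.
by apply: sub_sigma_algebra; apply: open_constant_around; rewrite ltr_wpDl// divr_gt0.
Qed.

Definition nondecreasing_path x := forall s t, 0 <= s -> s <= t -> (x s <= x t)%N.

Lemma nondecreasing_left_lim x s t : nondecreasing_path x -> 0 <= s -> s < t ->
  (x s <= left_lim x t)%N /\ (left_lim x t <= x t)%N.
Proof.
move=> xm s0 st; have t0 : 0 < t by exact: le_lt_trans st.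
have [d d0 xd] := cadlag_left_cst x t0.
pose u := Num.max ((s + t) / 2) (t - d / 2).
have u1 : (s + t) / 2 <= u by rewrite le_max lexx.
have u2 : t - d / 2 <= u by rewrite le_max lexx orbT.
have u3 : u < t by rewrite gt_max; apply/andP; split; lra.
rewrite -(xd u); last by apply/andP; split; lra.
by split; apply: xm; lra.
Qed.

(** Distinct jump times have distinct values, and the values up to time [t] are at
    most [x t]. *)
Lemma finite_jump_times x t : nondecreasing_path x ->
  finite_set (jump_times x `&` [set s | s <= t]).
Proof.
move=> xm.
have lt s u : jump_times x s -> jump_times x u -> s < u -> (x s < x u)%N.
  move=> [s0 _] [u0 /eqP ju] su.
  have [h1 h2] := nondecreasing_left_lim xm (ltW s0) su.
  by rewrite (leq_ltn_trans h1)// ltn_neqAle h2 eq_sym ju.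
apply: (finite_set_inj (f := x) (finite_II (x t).+1)) => [s [[s0 _] st]|s u [js _] [ju _] xsu].
  by rewrite /= ltnS; apply: xm => //; exact: ltW.
case: (ltgtP s u) => // su.
- by have := lt _ _ js ju su; rewrite xsu ltnn.
- by have := lt _ _ ju js su; rewrite xsu ltnn.
Qed.

Lemma increment_jump_time x s : 0 < s -> x s = (left_lim x s).+1 -> jump_times x s.
Proof. by move=> s0 j; split=> //; rewrite j => /esym/n_Sn. Qed.

Lemma jump_lt x s t : nondecreasing_path x -> jump_times x s -> s <= t ->
  (x 0%R < x t)%N.
Proof.
move=> xm [s0 /eqP js] st.
have [h1 h2] := nondecreasing_left_lim xm (lexx 0) s0.
apply: leq_trans (xm _ _ (ltW s0) st).
by rewrite (leq_ltn_trans h1)// ltn_neqAle h2 eq_sym js.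
Qed.

(** The jump time is the infimum of the times at which the path is positive. *)
Lemma unique_jump x t : nondecreasing_path x -> x 0 = 0%N -> x t = 1%N -> 0 <= t ->
  exists s, [/\ 0 < s <= t, x s = (left_lim x s).+1 &
    forall s', 0 < s' <= t -> jump_times x s' -> s' = s].
Proof.
move=> xm x0 xt t0.
pose U : set R := [set u | 0 <= u /\ (0 < x u)%N].
have Ut : U t by split=> //; rewrite xt.
have Ul : lbound U 0 by move=> u [].
have infU : has_inf U by split; [exists t|exists 0].
pose s := inf U.
have s0 : 0 <= s by apply: lb_le_inf => //; exists t.
have st : s <= t by apply: ge_inf => //; exists 0.
have below u : 0 <= u -> u < s -> x u = 0%N.
  move=> u0 us; apply/eqP; rewrite -leqn0 leqNgt; apply/negP => xu.
  by move: us; rewrite ltNge ge_inf//; exists 0.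
have xs : (0 < x s)%N.
  have [d d0 xd] := cadlag_right_cst x s0.
  have [u [u0 xu] us] := inf_adherent d0 infU.
  rewrite -(xd u)// us andbT; apply: ge_inf; first by exists 0.
  by split.
have s_gt0 : 0 < s.
  by rewrite lt_neqAle s0 andbT; apply/eqP => s0'; move: xs; rewrite -s0' x0.
have xs1 : x s = 1%N by apply/eqP; rewrite eqn_leq xs andbT -xt xm.
have ls : left_lim x s = 0%N.
  have [d d0 xd] := cadlag_left_cst x s_gt0.
  pose u := Num.max (s / 2) (s - d / 2).
  have u1 : s / 2 <= u by rewrite le_max lexx.
  have u2 : s - d / 2 <= u by rewrite le_max lexx orbT.
  have u3 : u < s by rewrite gt_max; apply/andP; split; lra.
  rewrite -(xd u); last by apply/andP; split; lra.
  by apply: below => //; lra.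
exists s; split; rewrite ?s_gt0 ?xs1 ?ls//.
move=> s' /andP[s'0 s't] [_ /eqP js].
have [_ h2] := nondecreasing_left_lim xm (lexx 0) s'0.
have {}h2 : (left_lim x s' < x s')%N by rewrite ltn_neqAle h2 eq_sym js.
case: (ltgtP s' s) => // ss'.
- by move: h2; rewrite (below _ (ltW s'0) ss').
- have [h _] := nondecreasing_left_lim xm s0 ss'.
  have : (x s' <= 1)%N by rewrite -xt xm// ltW.
  by rewrite leqNgt; move: (leq_ltn_trans h h2); rewrite xs1 => ->.
Qed.

End cadlag_paths.

(** * The exclusion dynamics during the first time step *)

Section dynamics.
Variables (R : realType) (S : countType).
Implicit Types (K : path_family R S) (e : oedge S) (x y z : S) (t : R).
Implicit Types (xi sigma : config S) (C : set S).

Definition touches e z := (z == (val e).1) || (z == (val e).2).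

(** The almost sure behaviour on which the analysis of the first time step rests: for
    nondecreasing paths started from 0, an edge is silent up to time [t] exactly when
    its value at time [t] is 0. *)
Definition regular K :=
  forall e, nondecreasing_path (K e) /\ K e 0 = 0%N.

Lemma Kpath_val K e : Kpath K (val e).1 (val e).2 = K e.
Proof.
rewrite /Kpath; case: insubP => [e' _ h|].
  by congr (cadlag_fun (K _)); apply: val_inj; rewrite h; case: (val e).
by rewrite -surjective_pairing (valP e).
Qed.

Lemma left_lim_cst0 t : left_lim (cst 0%N : R -> nat) t = 0%N.
Proof. exact: (lim_cst discrete_hausdorff). Qed.

Lemma unit_jump_edge K x y s : unit_jump K x y s ->
  exists2 e, val e = (x, y) & K e s = (left_lim (K e) s).+1.
Proof.
rewrite /unit_jump /Kpath; case: insubP => [e _ h|_]; last first.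
  by rewrite left_lim_cst0.
by move=> ?; exists e.
Qed.

Lemma unit_jump_count K e s t : regular K -> 0 < s <= t ->
  K e s = (left_lim (K e) s).+1 -> (0 < K e t)%N.
Proof.
move=> Kr /andP[s0 st] j; have [Km K0] := Kr e.
by rewrite -{1}K0; apply: (jump_lt (s := s)) => //; exact: increment_jump_time.
Qed.

Lemma finite_event_times K C t : regular K -> finite_set C ->
  finite_set (event_times K C 0 t).
Proof.
move=> Kr Cfin.
apply: (sub_finite_set (B := \bigcup_(p in C `*` C)
    ((if insub p is Some e then jump_times (K e) else set0) `&`
     [set s | s <= t]))).
  move=> s [/andP[s0 st] [x [y [Cx Cy xy /unit_jump_edge[e exy j]]]]].
  exists (x, y) => //=; split=> //.
  by rewrite -exy valK; exact: increment_jump_time.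
apply: bigcup_finite; first exact: finite_setX.
move=> p _; case: insubP => [e _ _|_]; last by rewrite set0I.
by apply: finite_jump_times; have [] := Kr e.
Qed.

(** A step can change the value at [z] only through a jump of an edge at [z]. *)
Lemma foldl_exclusion_quiet K C xi (L : seq R) z :
  (forall s, s \in L -> forall y, ~ unit_jump K z y s /\ ~ unit_jump K y z s) ->
  foldl (exclusion_step K C) xi L z = xi z.
Proof.
elim: L xi => // s L IH xi H /=; rewrite IH; last first.
  by move=> s' s'L; apply: H; rewrite inE s'L orbT.
have Hs := H s (mem_head _ _).
rewrite /exclusion_step asboolF; last by move=> [y [_ [_ _]]] /(proj1 (Hs y)).
by rewrite asboolF// => -[y [_ [_ _]]] /(proj2 (Hs y)).
Qed.

Section first_step.
Variables (t0 : R) (K : path_family R S) (t : R).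
Hypotheses (Kr : regular K) (t_ge0 : 0 <= t) (tt0 : t < t0).
Hypothesis (Kfin : finite_components (step_graph t0 K 0)).

Let C x := component (step_graph t0 K 0) x.
Let L x := sort <=%R (fset_set (event_times K (C x) 0 t)).

Lemma eta_first_step sigma x :
  eta t0 K sigma t x = foldl (exclusion_step K (C x)) sigma (L x) x.
Proof.
have t00 : 0 < t0 by exact: le_lt_trans tt0.
rewrite /eta (_ : Num.truncn _ = 0%N) /evolve ?mul0r//.
apply: truncn_def => /=.
by rewrite divr_ge0 ?(ltW t00)//= ltr_pdivrMr// mul1r.
Qed.

Lemma mem_event_list x s : (s \in L x) -> event_times K (C x) 0 t s.
Proof.
by rewrite mem_sort in_fset_set ?inE//; apply: finite_event_times.
Qed.

Lemma eta_quiet sigma z : (forall e, touches e z -> K e t = 0%N) ->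
  eta t0 K sigma t z = sigma z.
Proof.
move=> H; rewrite eta_first_step foldl_exclusion_quiet// => s /mem_event_list[st _] y.
by split=> /unit_jump_edge[e ezy /(unit_jump_count Kr st)]; rewrite H// /touches ezy eqxx ?orbT.
Qed.

Definition jump_along e sigma : config S :=
  if sigma (val e).1 && ~~ sigma (val e).2
  then exchange sigma (val e).1 (val e).2 else sigma.

(** Both ends of [e] lie in the component of [z], since [e] itself joins them in the
    graph of the first time step. In the list of the event times of that component, the
    jump time of [e] is the only one at which a site of [e] can be affected; the steps
    before and after it leave both ends unchanged. *)
Lemma eta_single_jump sigma e z : K e t = 1%N -> touches e z ->
  (forall e', e' != e -> touches e' (val e).1 || touches e' (val e).2 ->
     K e' t = 0%N) ->
  eta t0 K sigma t z = jump_along e sigma z.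
Proof.
move=> Ket ez Ho.
set u := (val e).1; set v := (val e).2.
have uv : u != v by rewrite /u /v; case: (e).
have [Km K0] := Kr e.
have [s [s0t js uniq_s]] := unique_jump Km K0 Ket t_ge0.
have uj : unit_jump K u v s by rewrite /unit_jump Kpath_val.
have only s' x y : 0 < s' <= t -> unit_jump K x y s' ->
    (x \in [:: u; v]) || (y \in [:: u; v]) -> [/\ x = u, y = v & s' = s].
  move=> s't /unit_jump_edge[e' e'xy j'] xyuv.
  have [e'e|e'e] := eqVneq e' e.
    rewrite /u /v -e'e e'xy; split=> //; apply: uniq_s => //.
    by rewrite -e'e; apply: increment_jump_time => //; case/andP: s't.
  have := unit_jump_count Kr s't j'; rewrite Ho// /touches e'xy/=.
  move: xyuv; rewrite !inE -/u -/v ![_ == x]eq_sym ![_ == y]eq_sym.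
  by do 4!case: (_ == _).
have Ksym_lt : (Ksym K u v 0%R < Ksym K u v t0)%N.
  rewrite /Ksym /u /v Kpath_val K0 add0n.
  apply: (@leq_ltn_trans (Kpath K v u t0)).
    rewrite /Kpath; case: insubP => // e' _ _; have [m _] := Kr e'.
    by apply: m => //; rewrite (le_trans t_ge0)// ltW.
  by rewrite -[X in (X < _)%N]add0n ltn_add2r -[X in (X <= _)%N]Ket Km// ltW.
have edge : step_graph t0 K 0 u v by rewrite /step_graph /jump_graph mul0r mul1r.
have edge' : step_graph t0 K 0 v u.
  by rewrite /step_graph /jump_graph mul0r mul1r /Ksym addnC [X in (_ < X)%N]addnC.
have [Cu Cv] : C z u /\ C z v.
  move: ez; rewrite /touches -/u -/v => /orP[]/eqP ->; split.
  - by exists [::].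
  - by exists [:: v] => //=; rewrite edge.
  - by exists [:: u] => //=; rewrite edge'.
  - by exists [::].
have sL : s \in L z.
  rewrite mem_sort in_fset_set ?inE; last exact: finite_event_times.
  by split=> //; exists u, v.
have Lu : uniq (L z) by rewrite sort_uniq fset_uniq.
have Lev := @mem_event_list z.
rewrite eta_first_step.
case/splitPr: sL Lu Lev => L1 L2.
rewrite cat_uniq/= => /and4P[_ + sL2 _] Lev.
rewrite negb_or => /andP[sL1 _].
have quiet s' y y' : s' \in L1 ++ L2 -> y \in [:: u; v] ->
    ~ unit_jump K y y' s' /\ ~ unit_jump K y' y s'.
  move=> s'L yuv; have s't : 0 < s' <= t.
    have [] // := Lev s'; move: s'L; rewrite !mem_cat inE.
    by case/orP => ->; rewrite ?orbT.
  have ns : s' <> s.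
    by move=> h; move: s'L; rewrite h mem_cat (negbTE sL1) (negbTE sL2).
  by split=> /only-/(_ s't); rewrite yuv ?orbT => -[].
have q1 y : y \in [:: u; v] -> foldl (exclusion_step K (C z)) sigma L1 y = sigma y.
  move=> yuv; apply: foldl_exclusion_quiet => s' s'L y'.
  by apply: quiet => //; rewrite mem_cat s'L.
have zuv : z \in [:: u; v] by move: ez; rewrite /touches !inE.
rewrite foldl_cat/= foldl_exclusion_quiet; last first.
  by move=> s' s'L y; apply: quiet => //; rewrite mem_cat s'L orbT.
set xi := foldl _ _ _.
have xiu : xi u = sigma u by apply: q1; rewrite !inE eqxx.
have xiv : xi v = sigma v by apply: q1; rewrite !inE eqxx orbT.
have movesP x y : moves K (C z) s xi x y -> (x \in [:: u; v]) || (y \in [:: u; v]) ->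
    [/\ x = u, y = v, sigma u & ~~ sigma v].
  move=> [_ [xix xiy j]] xyuv; have [xu yv _] := only _ _ _ s0t j xyuv.
  by rewrite -xiu -xiv -xu -yv.
have moves_uv : sigma u -> ~~ sigma v -> moves K (C z) s xi u v.
  by move=> su sv; split; split=> //; rewrite ?xiu ?xiv.
have [uin vin] : u \in [:: u; v] /\ v \in [:: u; v] by rewrite !inE !eqxx orbT.
rewrite /exclusion_step /jump_along -/u -/v /exchange.
move: zuv movesP moves_uv; move: (C z) => Cz.
rewrite !inE => /orP[]/eqP -> movesP moves_uv.
- case: ifPn => [/asboolP[y /movesP]|].
    by rewrite uin => /(_ isT)[_ _ su sv]; rewrite su sv/= eqxx (negbTE sv).
  move=> /asboolPn nm.
  have -> : sigma u && ~~ sigma v = false.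
    by apply/negP => /andP[su sv]; apply: nm; exists v; exact: moves_uv.
  rewrite asboolF ?xiu// => -[y /movesP]; rewrite uin orbT => /(_ isT)[_ vu].
  by move: uv; rewrite vu eqxx.
- rewrite asboolF; last first.
    move=> [y /movesP]; rewrite vin => /(_ isT)[vu].
    by move: uv; rewrite vu eqxx.
  case: ifPn => [/asboolP[y /movesP]|].
    rewrite vin orbT => /(_ isT)[_ _ su sv].
    by rewrite su sv/= eq_sym (negbTE uv) eqxx.
  move=> /asboolPn nm.
  have -> : sigma u && ~~ sigma v = false.
    by apply/negP => /andP[su sv]; apply: nm; exists u; exact: moves_uv.
  by rewrite xiv.
Qed.

End first_step.
End dynamics.

(** * Null sets *)

Section almost_everywhere_tools.
Context d (T : measurableType d) (R : realType) (P : probability T R).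

Lemma ae_forall_countable (I : countType) (Q : I -> T -> Prop) :
  (forall i, {ae P, forall w, Q i w}) -> {ae P, forall w, forall i, Q i w}.
Proof.
move=> H.
have /ae_foralln : forall n, {ae P, forall w, if choice.unpickle n is Some i then Q i w else True}.
  by move=> n; case: choice.unpickle => [i|]; [exact: H|exact: aeW].
by apply: filterS => w Hw i; have := Hw (choice.pickle i); rewrite choice.pickleK.
Qed.

Lemma ae_imply2 (A B C : T -> Prop) : {ae P, forall w, A w} -> {ae P, forall w, B w} ->
  (forall w, A w -> B w -> C w) -> {ae P, forall w, C w}.
Proof. by move=> hA hB H; exact: filterS2 H hA hB. Qed.

Lemma ae_probability1 (A : set T) : measurable A -> P A = 1%E ->
  {ae P, forall w, A w}.
Proof.
move=> mA PA; exists (~` A); split=> //; first exact: measurableC.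
by rewrite probability_setC// PA subee.
Qed.

(** The intersection of the supersets along a sequence is a null set that contains
    [A]. *)
Lemma negligible_small (A : set T) :
  (forall eps : R, 0 < eps -> exists2 B, measurable B & A `<=` B /\ (P B <= eps%:E)%E) ->
  P.-negligible A.
Proof.
move=> H.
have /choice[B HB] : forall n : nat, exists B, [/\ measurable B, A `<=` B &
    (P B <= (n.+1%:R^-1)%:E)%E].
  by move=> n; have [|B mB [AB PB]] := H n.+1%:R^-1; [rewrite invr_gt0|exists B].
exists (\bigcap_n B n); split.
- by apply: bigcapT_measurable => n; case: (HB n).
- apply/eqP; rewrite eq_le measure_ge0 andbT.
  apply/lee_addgt0Pr => e e0; rewrite add0e.
  have [n _ /(_ n (leqnn n))] := near_infty_natSinv_lt (PosNum e0).
  rewrite /= => ne; have [mB _ PB] := HB n.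
  apply: (@le_trans _ _ (P (B n))).
    by apply: le_measure; rewrite ?inE//; [apply: bigcapT_measurable => k; case: (HB k)|exact: bigcap_inf].
  by rewrite (le_trans PB)// lee_fin ltW.
- by move=> x Ax n _; have [_ + _] := HB n; apply.
Qed.

End almost_everywhere_tools.

(** * Increments of independent Poisson processes *)

Section poisson_family.
Variables (R : realType) (S : countType).
Implicit Types (e : oedge S) (s t : R).

Let T := path_family R S.

Lemma measurable_fun_coord e :
  measurable_fun setT (fun K : borel T => (K e : borel (cadlag R))).
Proof.
apply: measurability; first reflexivity.
move=> _ [U oU <-]; rewrite setTI; apply: sub_sigma_algebra.
have pc : continuous (fun K : T => K e).
  exact: (@proj_continuous (oedge S) (fun=> cadlag R) e).
exact: (continuousP _).1 pc U oU.
Qed.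

Lemma measurable_coord e (A : set (borel (cadlag R))) : measurable A ->
  measurable ([set K | A (K e)] : set (borel T)).
Proof.
by move=> mA; rewrite -[X in measurable X]setTI; exact: measurable_fun_coord.
Qed.

Lemma measurable_path_values (Q : nat -> nat -> Prop) s t : 0 <= s -> 0 <= t ->
  measurable ([set x | Q (x s) (x t)] : set (borel (cadlag R))).
Proof.
move=> s0 t0.
have -> : ([set x | Q (x s) (x t)] : set (borel (cadlag R))) =
    \bigcup_(p in [set p | Q p.1 p.2])
      (([set x | x s = p.1] : set (borel (cadlag R))) `&` [set x | x t = p.2]).
  apply/seteqP; split=> x /=; first by exists (x s, x t).
  by case=> -[n m] /= q [-> ->].
rewrite bigcup_mkcond; apply: countable_bigcupT_measurable; first exact: countableP.
by move=> p; case: ifP => // _; apply: measurableI; exact: measurable_eval.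
Qed.

Lemma measurable_values (Q : nat -> nat -> Prop) e s t : 0 <= s -> 0 <= t ->
  measurable ([set K | Q (K e s) (K e t)] : set (borel T)).
Proof.
by move=> s0 t0; exact: (measurable_coord e (measurable_path_values Q s0 t0)).
Qed.

Variables (c : S -> S -> R) (P : probability (borel T) R).
Hypotheses (hc : forall x y, 0 <= c x y) (hP : poisson_law c P).

Definition rate e : R := c (val e).1 (val e).2.

Lemma rate_ge0 e : 0 <= rate e. Proof. exact: hc. Qed.

Definition increment_is e s t n : set (borel T) := [set K | K e t = (K e s + n)%N].
Definition jumps e s t : set (borel T) := [set K | K e t <> K e s].
Definition jumps_again e s t : set (borel T) :=
  [set K | K e t <> K e s /\ K e t <> (K e s).+1].

Lemma measurable_increment_is e s t n : 0 <= s -> 0 <= t ->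
  measurable (increment_is e s t n).
Proof. exact: (measurable_values (fun a b => b = a + n)%N). Qed.

Lemma measurable_jumps e s t : 0 <= s -> 0 <= t -> measurable (jumps e s t).
Proof. exact: (measurable_values (fun a b => b <> a)). Qed.

Lemma measurable_jumps_again e s t : 0 <= s -> 0 <= t ->
  measurable (jumps_again e s t).
Proof. exact: (measurable_values (fun a b => b <> a /\ b <> a.+1)). Qed.

Lemma increment_prob e s t n : 0 <= s -> s <= t ->
  P (increment_is e s t n) = poisson_prob (rate e * (t - s)) 0%N [set n].
Proof. by move=> s0 st; have [_ + _] := hP.1 e; apply. Qed.

Lemma poisson_prob_point (m : R) n : 0 <= m ->
  poisson_prob m 0%N [set n] = (m ^+ n / n`!%:R * expR (- m))%:E.
Proof.
rewrite le_eqVlt => /predU1P[<-|m0]; rewrite /poisson_prob ?ltxx.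
  rewrite diracE oppr0 expR0 mulr1 expr0n; case: n => [|n].
    by rewrite /= fact0 divr1 mem_set.
  by rewrite mul0r memNset//.
rewrite m0 esum_set1; last by rewrite lee_fin poisson_pmf_ge0.
by rewrite /poisson_pmf m0.
Qed.

Lemma no_jump_prob e s t : 0 <= s -> s <= t ->
  P (~` jumps e s t) = (expR (- (rate e * (t - s))))%:E.
Proof.
move=> s0 st; have := increment_prob e 0 s0 st.
rewrite poisson_prob_point ?expr0 ?fact0 ?divr1 ?mul1r; last first.
  by rewrite mulr_ge0 ?rate_ge0 ?subr_ge0.
move=> <-; congr (P _); apply/seteqP; split=> K /=; rewrite /increment_is/= addn0.
  by move/contrapT.
by move=> h; apply.
Qed.

Lemma jumps_prob e s t : 0 <= s -> s <= t ->
  P (jumps e s t) = (1 - expR (- (rate e * (t - s))))%:E.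
Proof.
move=> s0 st; rewrite -[jumps e s t]setCK probability_setC ?no_jump_prob//.
by apply: measurableC; apply: measurable_jumps => //; exact: le_trans st.
Qed.

Lemma jumps_prob_le e s t : 0 <= s -> s <= t ->
  (P (jumps e s t) <= (rate e * (t - s))%:E)%E.
Proof.
move=> s0 st; rewrite jumps_prob// lee_fin.
by have := expR_ge1Dx (- (rate e * (t - s))); lra.
Qed.

(** With [m] the expected number of jumps, the probability is
    [1 - (1 + m) exp (- m)], and [exp (- m) >= 1 - m]. *)
Lemma jumps_again_prob_le e s t : 0 <= s -> s <= t ->
  (P (jumps_again e s t) <= ((rate e * (t - s)) ^+ 2)%:E)%E.
Proof.
move=> s0 st; have t0 := le_trans s0 st.
have mI n := measurable_increment_is e n s0 t0.
have -> : jumps_again e s t = ~` (increment_is e s t 0 `|` increment_is e s t 1).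
  apply/seteqP; split=> K; rewrite /jumps_again /increment_is/= addn0 addn1.
    by move=> [? ?] [].
  by move/not_orP.
rewrite probability_setC; last exact: measurableU.
have -> : P (increment_is e s t 0 `|` increment_is e s t 1) =
    (poisson_prob (rate e * (t - s)) 0%N [set 0%N] +
     poisson_prob (rate e * (t - s)) 0%N [set 1%N])%E.
  rewrite measureU//; first by congr (_ + _)%E; exact: increment_prob.
  apply/seteqP; split=> K //; rewrite /increment_is/= => -[-> /eqP].
  by rewrite eqn_add2l.
rewrite !poisson_prob_point ?mulr_ge0 ?rate_ge0 ?subr_ge0//.
set m := rate e * (t - s).
have m0 : 0 <= m by rewrite mulr_ge0 ?rate_ge0 ?subr_ge0.
rewrite expr0 expr1 factS fact0 !divr1 mul1r -EFinD lee_fin.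
have := expR_ge1Dx (- m); have := expR_gt0 (- m); nra.
Qed.

(** The Poisson probabilities of the increments [0, 1, 2, ...] sum to 1, so the
    increment is almost surely one of them. *)
Lemma nondecreasing_values_ae e s t : 0 <= s -> s <= t ->
  {ae P, forall K : borel T, (K e s <= K e t)%N}.
Proof.
move=> s0 st; have t0 := le_trans s0 st.
apply: ae_probability1; first exact: (measurable_values (fun n m => n <= m)%N).
rewrite [X in P X](_ : _ = \bigcup_n increment_is e s t n); last first.
  apply/seteqP; split=> K /=.
    by move=> h; exists (K e t - K e s)%N => //; rewrite /increment_is/= subnKC.
  by case=> n _; rewrite /increment_is /= => ->; rewrite leq_addr.
rewrite measure_bigcup; last 2 first.
- by move=> n _; exact: measurable_increment_is.
- by move=> n m _ _ [K []]; rewrite /increment_is/= => -> /eqP; rewrite eqn_add2l => /eqP ->.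
rewrite (eq_eseriesr (fun n _ => increment_prob e n s0 st)).
rewrite -(probability_setT (poisson_prob (rate e * (t - s)) 0%N)).
rewrite [in RHS](_ : setT = \bigcup_n [set n]); last first.
  by apply/seteqP; split=> n //= _; exists n.
by rewrite measure_bigcup//; move=> n m _ _ [k /= [-> ->]].
Qed.

(** Monotonicity along rational times extends to all times by
    right-continuity. *)
Lemma regular_ae : {ae P, forall K : borel T, regular K}.
Proof.
have H0 e : {ae P, forall K : borel T, K e 0 = 0%N} by have [] := hP.1 e.
have Hq e (p : rat * rat) : {ae P, forall K : borel T,
    0 <= ratr p.1 :> R -> (ratr p.1 <= ratr p.2 :> R) ->
    (K e (ratr p.1 : R) <= K e (ratr p.2 : R))%N}.
  have [p1|] := boolP (0 <= ratr p.1 :> R); last by move=> _; apply: aeW.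
  have [p2|] := boolP (ratr p.1 <= ratr p.2 :> R); last by move=> _; apply: aeW.
  by apply: filterS (nondecreasing_values_ae e p1 p2).
have {H0} := ae_forall_countable H0.
have {Hq} := ae_forall_countable (fun e => ae_forall_countable (Hq e)).
apply: filterS2 => K Hq H0 e; split=> // s t s0.
rewrite le_eqVlt => /predU1P[<-//|st].
have t0 : 0 <= t by exact: le_trans (ltW st).
have [d d0 Kd] := cadlag_right_cst (K e) s0.
have [d' d'0 Kd'] := cadlag_right_cst (K e) t0.
have [|q q1] := @rat_in_itvoo R s (Num.min t (s + d)).
  by rewrite lt_min st/= ltrDl.
have [|q' q'1] := @rat_in_itvoo R t (t + d'); first by rewrite ltrDl.
move: q1 q'1; rewrite !in_itv/= lt_min => /and3P[q1 q2 q3] /andP[q4 q5].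
rewrite -(Kd (ratr q)); last by rewrite (ltW q1).
rewrite -(Kd' (ratr q')); last by rewrite (ltW q4).
apply: (Hq e (q, q')) => /=; first by rewrite (le_trans s0)// ltW.
by rewrite ltW// (lt_trans q2).
Qed.

Lemma edges_independent e e' (A B : set (borel (cadlag R))) : e != e' ->
  measurable A -> measurable B ->
  P ([set K | A (K e)] `&` [set K | B (K e')]) =
  (P [set K | A (K e)] * P [set K | B (K e')])%E.
Proof.
move=> ee' mA mB.
pose F i := if i == e then A else B.
have := hP.2 [fset e; e']%fset F.
rewrite big_fsetU1/= ?inE// big_seq_fset1 /F eqxx eq_sym (negbTE ee') => <-.
  congr (P _); apply/seteqP; split=> K /=.
    by move=> [Ae Be] i /=; rewrite !inE => /orP[]/eqP ->; rewrite ?eqxx// eq_sym (negbTE ee').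
  move=> H; split; first by have := H e; rewrite /= eqxx; apply; rewrite !inE eqxx.
  by have := H e'; rewrite /= eq_sym (negbTE ee'); apply; rewrite !inE eqxx orbT.
by move=> i; case: ifP.
Qed.

Lemma two_jumps_prob_le e e' s t : e != e' -> 0 <= s -> s <= t ->
  (P (jumps e s t `&` jumps e' s t) <= (rate e * rate e' * (t - s) ^+ 2)%:E)%E.
Proof.
move=> ee' s0 st; have t0 := le_trans s0 st.
have mA := measurable_path_values (fun n m => m <> n) s0 t0.
rewrite [P _](edges_independent ee' mA mA).
rewrite (_ : rate e * rate e' * _ = (rate e * (t - s)) * (rate e' * (t - s))); last first.
  by rewrite expr2 mulrACA.
by rewrite EFinM; apply: lee_pmul => //; exact: jumps_prob_le.
Qed.

End poisson_family.

(** * Sums over countable sets *)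

Section esum_tools.
Variable R : realType.
Local Open Scope ereal_scope.

Lemma esum_tail (I : choiceType) (D : set I) (a : I -> \bar R) (eps : R) :
  (forall i, D i -> 0 <= a i) -> \esum_(i in D) a i < +oo -> (0 < eps)%R ->
  exists F : {fset I}, [set` F] `<=` D /\ \esum_(i in D `\` [set` F]) a i <= eps%:E.
Proof.
move=> a0 afin eps0.
have esfin : \esum_(i in D) a i \is a fin_num by rewrite ge0_fin_numE// esum_ge0.
have [_ [X [Xfin XD] <-]] := ub_ereal_sup_adherent eps0 esfin.
rewrite -/(esum D a) => h.
exists (fset_set X); rewrite fset_setK//; split=> //.
move: h esfin; rewrite (esumID X)// setIidr// esum_fset//; last first.
  by move=> i; rewrite inE => /XD /a0.
rewrite -setDE; set u := \sum_(_ \in _) _; set v := \esum_(_ in _) _ => h.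
rewrite fin_numD => /andP[ufin vfin].
move: h; rewrite -(fineK ufin) -(fineK vfin) -EFinD lte_fin lee_fin; lra.
Qed.

Lemma esum_finite_support (I : choiceType) (D : set I) (a : I -> \bar R) :
  (forall i, 0 <= a i < +oo) -> finite_set [set i | D i /\ a i != 0] ->
  \esum_(i in D) a i < +oo.
Proof.
move=> ha afin.
rewrite (_ : \esum_(i in D) a i = \esum_(i in [set i | D i /\ a i != 0]) a i); last first.
  rewrite esum_mkcond [RHS]esum_mkcond; apply: eq_esum => i _.
  have [Di|Di] := boolP (i \in D); last first.
    by rewrite memNset// => -[/mem_set]; rewrite (negbTE Di).
  have [/eqP ai0|ai0] := boolP (a i == 0); first by rewrite ai0; case: ifP.
  by rewrite mem_set//; split=> //; exact: set_mem.
rewrite esum_fset//; last by move=> i _; case/andP: (ha i).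
rewrite fsbig_finite//=; apply: lte_sum_pinfty => i _.
by case/andP: (ha i).
Qed.

Lemma esumZ_le (I : choiceType) (D : set I) (a : I -> \bar R) (k : R) :
  (0 <= k)%R -> (forall i, 0 <= a i) ->
  \esum_(i in D) (k%:E * a i) <= k%:E * \esum_(i in D) a i.
Proof.
move=> k0 a0; apply: ge_ereal_sup => _ [X [Xfin XD] <-].
rewrite -ge0_mule_fsumr//; apply: lee_wpmul2l; first by rewrite lee_fin.
by apply: ereal_sup_ubound; exists X.
Qed.

Lemma esum_pinfty_gt (I : choiceType) (D : set I) (a : I -> R) (M : R) :
  \esum_(i in D) (a i)%:E = +oo ->
  exists2 F : {fset I}, [set` F] `<=` D & (M < \sum_(i <- F) a i)%R.
Proof.
move=> aoo; apply: contrapT => nF.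
have : \esum_(i in D) (a i)%:E <= M%:E.
  apply: ge_ereal_sup => _ [X [Xfin XD] <-].
  rewrite fsbig_finite// sumEFin lee_fin leNgt; apply/negP => MX.
  by apply: nF; exists (fset_set X) => //; rewrite fset_setK.
by rewrite aoo leye_eq.
Qed.

Lemma measure_bigcup_countable_le d (T : measurableType d) (P : {measure set T -> \bar R})
    (I : countType) (D : set I) (A : I -> set T) :
  (forall i, measurable (A i)) ->
  measurable (\bigcup_(i in D) A i) /\ P (\bigcup_(i in D) A i) <= \esum_(i in D) P (A i).
Proof.
move=> mA.
pose B n := if @choice.pickle_inv I n is Some i then (if i \in D then A i else set0) else set0.
have mB n : measurable (B n) by rewrite /B; case: choice.pickle_inv => // i; case: ifP.
have BE : \bigcup_(i in D) A i = \bigcup_n B n.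
  apply/seteqP; split=> x.
    move=> [i Di Ai]; exists (choice.pickle i) => //.
    by rewrite /B choice.pickleK_inv mem_set.
  move=> [n _]; rewrite /B; case: choice.pickle_inv => // i.
  by case: ifP => // /set_mem Di; exists i.
rewrite BE; split; first exact: bigcupT_measurable.
apply: (@le_trans _ _ (\sum_(n <oo) P (B n))).
  by apply: measure_sigma_subadditive => //; exact: bigcupT_measurable.
rewrite nneseries_esumT//.
have injp : set_bij D (choice.pickle @` D) (@choice.pickle I).
  apply: inj_bij => i j _ _ /(congr1 (@choice.pickle_inv I)).
  by rewrite !choice.pickleK_inv => -[].
rewrite (_ : \esum_(i in D) P (A i) = \esum_(i in D) P (B (choice.pickle i))); last first.
  by apply: eq_esum => i Di; rewrite /B choice.pickleK_inv mem_set.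
rewrite -(reindex_esum _ _ _ (fun n => P (B n)) injp) [leRHS]esum_mkcond.
apply: le_esum => n _; case: ifPn => // /negP nD.
rewrite /B; case E : choice.pickle_inv => [i|]; last by rewrite measure0.
case: ifPn => [/set_mem Di|]; last by rewrite measure0.
exfalso; apply: nD; apply: mem_set; exists i => //.
by have := @choice.pickle_invK I n; rewrite E.
Qed.

End esum_tools.

(** * Almost sure properties of the jump times *)

Section almost_sure_properties.
Variables (R : realType) (S : countType).
Implicit Types (e : oedge S) (s t : R).

Let T := path_family R S.

Variables (c : S -> S -> R) (P : probability (borel T) R).
Hypotheses (hc : forall x y, 0 <= c x y) (hP : poisson_law c P).

Let rate := rate c.

(** Cut [[0, N]] into [n] intervals of equal length: the probability that [A] occurs on
    one of them is at most [n * C * (N / n) ^ 2], which tends to 0. Applied to the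
    occurrence of two jumps in the interval, this excludes simultaneous jumps of two
    edges, and jumps of size larger than 1. *)
Lemma ae_no_time_in_rare_intervals (A : R -> R -> set (borel T)) (C : R) : 0 <= C ->
  (forall s t, 0 <= s -> s <= t -> measurable (A s t)) ->
  (forall s t, 0 <= s -> s <= t -> (P (A s t) <= (C * (t - s) ^+ 2)%:E)%E) ->
  {ae P, forall K, forall u, 0 < u -> ~ (forall s t, 0 <= s -> s < u -> u <= t -> A s t K)}.
Proof.
move=> C0 mA PA.
have /ae_foralln : forall N : nat, {ae P, forall K, forall u, 0 < u <= N.+1%:R ->
    ~ (forall s t, 0 <= s -> s < u -> u <= t -> A s t K)}; last first.
  apply: filterS => K HK u u0; apply: (HK (Num.truncn u)).
  by rewrite u0/= ltW// truncnS_gt.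
move=> N; apply: negligible_small => eps eps0.
pose L : R := N.+1%:R.
have L0 : 0 < L by [].
pose n := (Num.truncn (C * L ^+ 2 / eps)).+1.
have n0 : 0 < n%:R :> R by rewrite ltr0n.
have neps : C * L ^+ 2 / n%:R <= eps.
  by rewrite ler_pdivrMr// [eps * _]mulrC -ler_pdivrMr// ltW// /n truncnS_gt.
pose h : R := L / n%:R.
have h0 : 0 < h by rewrite divr_gt0.
pose B (i : nat) := A (i%:R * h) (i.+1%:R * h).
have ih i : 0 <= i%:R * h /\ i%:R * h <= i.+1%:R * h.
  by rewrite mulr_ge0 ?(ltW h0)// ler_wpM2r ?(ltW h0)// ler_nat.
have mB i : measurable (B i) by apply: mA; case: (ih i).
exists (\big[setU/set0]_(i < n) B i).
  by apply: bigsetU_measurable => i _.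
split.
  move=> K /= /existsNP[u] /not_implyP[/andP[u0 uL] /contrapT HK].
  have ex : exists j, u <= j%:R * h.
    by exists n; rewrite /h mulrC -mulrA mulVf ?mulr1// gt_eqF.
  rewrite -bigcup_mkord; case: (ex_minnP ex) => -[|i] ui imin.
    by move: ui; rewrite mul0r leNgt u0.
  exists i => /=.
    by apply: imin; rewrite /h mulrC -mulrA mulVf ?mulr1// gt_eqF.
  apply: HK => //; first by case: (ih i).
  by rewrite ltNge; apply/negP => /imin; rewrite ltnn.
apply: (le_trans (@le_mu_bigsetU _ _ _ P B n (fun i _ => mB i))).
apply: (@le_trans _ _ (\sum_(i < n) (C * h ^+ 2)%:E)%E).
  apply: lee_sum => i _; have [i0 i1] := ih i.
  rewrite (le_trans (PA _ _ i0 i1))// lee_fin -mulrBl -natr1 [_ + 1]addrC addrK mul1r.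
  by rewrite lexx.
rewrite sumEFin lee_fin sumr_const card_ord -mulr_natr (le_trans _ neps)//.
rewrite (_ : C * h ^+ 2 * n%:R = C * L ^+ 2 / n%:R)// /h.
by field; rewrite gt_eqF.
Qed.

Lemma disjoint_jump_times_ae e e' : e != e' ->
  {ae P, forall K : borel T, jump_times (K e) `&` jump_times (K e') = set0}.
Proof.
move=> ee'.
have H := @ae_no_time_in_rare_intervals (fun s t => jumps e s t `&` jumps e' s t)
  (rate e * rate e') (mulr_ge0 (rate_ge0 hc e) (rate_ge0 hc e')).
have {}H : {ae P, forall K, forall u, 0 < u -> ~ (forall s t, 0 <= s -> s < u ->
    u <= t -> (jumps e s t `&` jumps e' s t) K)}.
  apply: H => s t s0 st; last exact: two_jumps_prob_le.
  by apply: measurableI; apply: measurable_jumps => //; exact: le_trans st.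
have := regular_ae hP; move: H; apply: filterS2 => K HK Kr.
rewrite -subset0 => u [[u0 ju] [_ ju']]; apply: (HK u u0) => s t s0 su ut.
split.
- have [Km _] := Kr e; have [h1 h2] := nondecreasing_left_lim Km s0 su.
  have h3 := Km _ _ (ltW u0) ut.
  by move=> Kts; apply: ju; apply/eqP; rewrite eqn_leq h2 andbT (leq_trans h3)// Kts.
- have [Km _] := Kr e'; have [h1 h2] := nondecreasing_left_lim Km s0 su.
  have h3 := Km _ _ (ltW u0) ut.
  by move=> Kts; apply: ju'; apply/eqP; rewrite eqn_leq h2 andbT (leq_trans h3)// Kts.
Qed.

Lemma jumps_by_one_ae e : {ae P, forall K : borel T, forall t,
  jump_times (K e) t -> K e t = (left_lim (K e) t).+1}.
Proof.
have := @ae_no_time_in_rare_intervals (jumps_again e) (rate e ^+ 2) (sqr_ge0 _).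
move=> H; have {}H : {ae P, forall K, forall u, 0 < u ->
    ~ (forall s t, 0 <= s -> s < u -> u <= t -> jumps_again e s t K)}.
  apply: H => s t s0 st; last by rewrite -exprMn; exact: jumps_again_prob_le.
  by apply: measurable_jumps_again => //; exact: le_trans st.
have := regular_ae hP; move: H; apply: filterS2 => K HK Kr u [u0 ju].
apply: contrapT => nj; apply: (HK u u0) => s t s0 su ut.
have [Km _] := Kr e; have [h1 h2] := nondecreasing_left_lim Km s0 su.
have h3 := Km _ _ (ltW u0) ut.
by move: h1 h2 h3 ju nj; rewrite /jumps_again/=; lia.
Qed.

Lemma no_jumps_prob (J : {fset oedge S}) s t : 0 <= s -> s <= t ->
  P (\bigcap_(e in [set` J]) ~` jumps e s t) =
  (expR (- ((\sum_(e <- J) rate e) * (t - s))))%:E.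
Proof.
move=> s0 st.
have mA := measurable_path_values (fun n m => ~ (m <> n)) s0 (le_trans s0 st).
rewrite [LHS](hP.2 J _ (fun=> mA)).
rewrite mulr_suml -sumrN expR_sum -prodEFin; apply: eq_bigr => e _.
exact: (no_jump_prob hc hP e s0 st).
Qed.

(** An edge at [x] that jumps joins two vertices of the component of [x]. *)
Lemma finite_jumping_edges (K : T) x t0 : 0 < t0 -> regular K ->
  finite_components (jump_graph K 0 t0) ->
  finite_set [set e : oedge S | touches e x /\ K e t0 <> K e 0].
Proof.
move=> t0_gt0 Kr /(_ x) Cfin.
apply: (finite_set_inj (finite_setX Cfin Cfin) (f := val)); last first.
  by move=> e e' _ _ /val_inj.
move=> e [ex je].
have lt : (Ksym K (val e).1 (val e).2 0%R < Ksym K (val e).1 (val e).2 t0)%N.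
  rewrite /Ksym Kpath_val; apply: (@leq_ltn_trans (K e 0%R + Kpath K (val e).2 (val e).1 t0)).
    rewrite leq_add2l /Kpath; case: insubP => // e' _ _.
    by have [Km _] := Kr e'; apply: Km => //; exact: ltW.
  rewrite ltn_add2r ltn_neqAle; have [Km _] := Kr e; rewrite (Km _ _ (lexx 0) (ltW t0_gt0)) andbT.
  by apply/eqP => h; exact: je.
have edge : jump_graph K 0 t0 (val e).1 (val e).2 by [].
have edge' : jump_graph K 0 t0 (val e).2 (val e).1.
  by rewrite /jump_graph /Ksym addnC [X in (_ < X)%N]addnC.
move: ex; rewrite /touches => /orP[]/eqP ->; split.
- by exists [::].
- by exists [:: (val e).2] => //=; rewrite edge.
- by exists [:: (val e).1] => //=; rewrite edge'.
- by exists [::].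
Qed.

(** Summability of the rates at a vertex is a consequence of the finiteness of the
    components. If the sum were infinite, infinitely many edges at [x] would jump before
    [t0]: by independence, the probability that no edge of index at least [n] does is at
    most [exp (- t0 * s)] for every partial sum [s] of their rates (second Borel-Cantelli
    lemma). The component of [x] would then be infinite. *)
Lemma rate_sum_finite (t0 : R) x : assumption_SEP P t0 ->
  (\esum_(e in [set e : oedge S | touches e x]) (rate e)%:E < +oo)%E.
Proof.
move=> [t0_gt0 hSEP]; rewrite ltNge leye_eq; apply/negP => /eqP rate_oo.
have t00 := ltW t0_gt0.
pose W n := \bigcap_(e in [set e : oedge S | touches e x /\ (n <= choice.pickle e)%N])
  ~` jumps e 0 t0.
have Wnull n : P.-negligible (W n).
  apply: negligible_small => eps eps0.
  pose D := [set e : oedge S | touches e x].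
  pose D' := [set e : oedge S | touches e x /\ (n <= choice.pickle e)%N].
  have D'oo : (\esum_(e in D') (rate e)%:E = +oo)%E.
    apply: contrapT => /eqP; rewrite -leye_eq -ltNge => D'fin.
    have rate0 i : (0 <= (rate i)%:E)%E by rewrite lee_fin rate_ge0.
    move: rate_oo; rewrite (esumID [set e : oedge S | (choice.pickle e < n)%N])//.
    rewrite (_ : _ `&` ~` _ = D'); last first.
      apply/seteqP; split=> e [ex /= h]; split=> //.
        by rewrite leqNgt; exact/negP.
      by apply/negP; rewrite -leqNgt.
    have /lte_add_pinfty/(_ D'fin) : (\esum_(e in [set e | touches e x] `&`
        [set e : oedge S | (choice.pickle e < n)%N]) (rate e)%:E < +oo)%E.
      apply: esum_finite_support => [e|]; first by rewrite rate0 ltry.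
      by apply/finite_set_pickle; exists n => e [[]].
    by move=> /[swap] ->; rewrite ltxx.
  (* [exp (- y) <= 1 / (1 + y) <= eps] as soon as [y >= 1 / eps] *)
  have [J JD' Jbig] := esum_pinfty_gt (eps^-1 / t0) D'oo.
  exists (\bigcap_(e in [set` J]) ~` jumps e 0 t0).
    by apply: fin_bigcap_measurable => // e _; apply: measurableC; exact: measurable_jumps.
  split; first by move=> K WK e eJ; apply: WK; exact: JD'.
  rewrite no_jumps_prob// lee_fin subr0 expRN.
  rewrite -[leRHS]invrK lef_pV2 ?posrE ?invr_gt0 ?expR_gt0//.
  move: Jbig; rewrite ltr_pdivrMr// => /ltW/le_trans; apply.
  by rewrite (le_trans _ (expR_ge1Dx _))// lerDr.
have : {ae P, forall K : borel T, [/\ regular K,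
    finite_components (jump_graph K 0 t0) & forall n, ~ W n K]}.
  have h1 : {ae P, forall K : borel T, forall n, ~ W n K}.
    by apply: ae_forall_countable => n; apply: negligibleS (Wnull n) => K /= /contrapT.
  have h2 : {ae P, forall K : borel T, regular K} := regular_ae hP.
  have h3 : {ae P, forall K : borel T, finite_components (jump_graph K 0 t0)} := hSEP.
  by move: h1 h2 h3; apply: filterS3 => K.
have Ppos : (0 < P [set: borel T])%E by rewrite probability_setT.
move/(@filter_ex _ _ (ae_properfilter_algebraOfSetsType Ppos)) => [K [Kr Kfin KW]].
have : finite_set [set e : oedge S | touches e x /\ K e t0 <> K e 0].
  exact: finite_jumping_edges.
case/finite_set_pickle => n Kn; apply: (KW n) => e [ex ne] /= je.
by have := Kn e (conj ex je); rewrite ltnNge ne.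
Qed.

(** First Borel-Cantelli lemma: the edges at [x] outside a large finite set have a small
    total rate, so with high probability none of them jumps before time [N]. *)
Lemma finite_jumping_edges_ae x : (\esum_(e in [set e : oedge S | touches e x]) (rate e)%:E < +oo)%E ->
  {ae P, forall K : borel T, forall N : nat,
    finite_set [set e : oedge S | touches e x /\ K e N%:R <> K e 0]}.
Proof.
move=> Dfin; apply: ae_forall_countable => N.
have rate0 i : (0 <= (rate i)%:E)%E by rewrite lee_fin rate_ge0.
apply: negligible_small => eps eps0.
have N0 : 0 < N.+1%:R :> R by [].
have [F [FD Ftail]] := esum_tail (fun i _ => rate0 i) Dfin (divr_gt0 eps0 N0).
set D := [set e : oedge S | touches e x] in Dfin FD Ftail.
have mJ (e : oedge S) : measurable (jumps e 0 N%:R : set (borel T)) by exact: measurable_jumps.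
have [mB PB] := measure_bigcup_countable_le P (D `\` [set` F]) mJ.
exists (\bigcup_(e in D `\` [set` F]) jumps e 0 N%:R) => //; split.
  move=> K /= Kinf; apply: contrapT => KB; apply: Kinf.
  apply: sub_finite_set (finite_fset F) => e [ex je].
  by apply: contrapT => eF; apply: KB; exists e.
apply: (le_trans PB).
apply: (@le_trans _ _ (\esum_(e in D `\` [set` F]) (N%:R%:E * (rate e)%:E)))%E.
  apply: le_esum => e _; rewrite -EFinM mulrC.
  by have := jumps_prob_le hc hP e (lexx 0) (ler0n R N); rewrite subr0.
apply: (le_trans (esumZ_le _ _ _)) => //.
apply: (@le_trans _ _ (N%:R%:E * (eps / N.+1%:R)%:E)%E).
  by apply: lee_wpmul2l => //; rewrite lee_fin.
by rewrite -EFinM lee_fin mulrA ler_pdivrMr// mulrC ler_pM2l// ler_nat.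
Qed.

End almost_sure_properties.

(** * Random subsets of edges and their components *)

Section edge_patterns.
Variable S : countType.
Implicit Types (w : oedge S -> bool).

(** A pi-system that generates the product sigma-algebra, on which the law of a random
    pattern is given by its void probabilities. *)
Definition void_events : set (set (oedge S -> bool)) :=
  [set A | exists J : {fset oedge S}, A = [set w | forall e, e \in J -> ~~ w e]].

Lemma setI_closed_void_events : setI_closed void_events.
Proof.
move=> _ _ [J ->] [J' ->]; exists (J `|` J')%fset.
apply/seteqP; split=> w /=.
  by move=> [wJ wJ'] e; rewrite inE => /orP[/wJ|/wJ'].
by move=> H; split=> e eJ; apply: H; rewrite inE eJ ?orbT.
Qed.

Definition marked w (p : S * S) : bool := if insub p is Some e then w e else false.

Definition pattern_graph w : rel S := fun x y => marked w (x, y) || marked w (y, x).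

Let W := g_sigma_algebraType void_events.

Lemma measurable_pattern e : measurable [set w : W | w e].
Proof.
have -> : [set w : W | w e] = ~` [set w : W | forall e', e' \in [fset e]%fset -> ~~ w e'].
  apply/seteqP; split=> w /=; first by move=> we /(_ e); rewrite inE eqxx we => /(_ isT).
  move=> H; apply: contrapT => /negP nwe; apply: H => e'.
  by rewrite inE => /eqP ->.
by apply: measurableC; apply: sub_sigma_algebra; exists [fset e]%fset.
Qed.

Lemma measurable_pattern_graph x y : measurable [set w : W | pattern_graph w x y].
Proof.
have mo (p : S * S) : measurable [set w : W | marked w p].
  rewrite /marked; case: insubP => [e _ _|_]; first exact: measurable_pattern.
  by rewrite (_ : mkset _ = set0); [exact: measurable0|apply/seteqP; split].
have -> : [set w : W | pattern_graph w x y] =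
    [set w : W | marked w (x, y)] `|` [set w : W | marked w (y, x)].
  by rewrite eqEsubset; split=> w /= => [/orP|H]; last exact/orP.
exact: measurableU.
Qed.

Lemma measurable_pattern_path x (p : seq S) :
  measurable [set w : W | path (pattern_graph w) x p].
Proof.
elim: p x => [|y p IH] x /=.
  have -> : [set w : W | true] = setT by apply/seteqP; split.
  exact: measurableT.
have -> : [set w : W | pattern_graph w x y && path (pattern_graph w) y p] =
    [set w : W | pattern_graph w x y] `&` [set w : W | path (pattern_graph w) y p].
  by rewrite eqEsubset; split=> w /= => [/andP|H]; last exact/andP.
by apply: measurableI => //; exact: measurable_pattern_graph.
Qed.

Lemma measurable_forall_countable d (T : measurableType d) (I : countType) (A : I -> set T) :
  (forall i, measurable (A i)) -> measurable [set w | forall i, A i w].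
Proof.
move=> mA; rewrite (_ : mkset _ = ~` \bigcup_i ~` A i).
  apply: measurableC; apply: countable_bigcupT_measurable; first exact: countableP.
  by move=> i; exact: measurableC.
by rewrite setC_bigcup; apply/seteqP; split=> w /=; [move=> H i _; rewrite setCK; exact: H
  |move=> H i; have := H i Logic.I; rewrite setCK].
Qed.

(** A component is finite iff the indices of its vertices are bounded, and membership of
    a component is decided by the countably many finite paths. *)
Lemma measurable_finite_components :
  measurable [set w : W | finite_components (pattern_graph w)].
Proof.
have -> : [set w : W | finite_components (pattern_graph w)] =
    [set w | forall x, (\bigcup_n [set w : W | forall p : seq S,
    path (pattern_graph w) x p -> (choice.pickle (last x p) < n)%N]) w].
  apply/seteqP; split=> w /= H x.
    have [n Hn] := (finite_set_pickle _).1 (H x); exists n => //= p xp.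
    by apply: Hn; exists p.
  by have [n _ Hn] := H x; apply/finite_set_pickle; exists n => _ [p xp ->]; exact: Hn.
apply: measurable_forall_countable => x; apply: bigcupT_measurable => n.
apply: measurable_forall_countable => p.
have [pn|pn] := boolP (choice.pickle (last x p) < n)%N.
  have -> : (fun w : W => path (pattern_graph w) x p -> true) = setT.
    by apply/seteqP; split.
  exact: measurableT.
have -> : (fun w : W => path (pattern_graph w) x p -> false) =
    ~` [set w : W | path (pattern_graph w) x p].
  by apply/seteqP; split=> w /=; [move=> H /H|].
by apply: measurableC; exact: measurable_pattern_path.
Qed.

End edge_patterns.

(** * Almost sure validity of the graphical construction *)

Section stationarity.
Variables (R : realType) (S : countType).
Implicit Types (e : oedge S) (s t a b : R).

Let T := path_family R S.

Variables (c : S -> S -> R) (P : probability (borel T) R).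
Hypotheses (hc : forall x y, 0 <= c x y) (hP : poisson_law c P).

Definition jump_pattern a b (K : borel T) : g_sigma_algebraType (@void_events S) :=
  fun e => K e b != K e a.

Lemma preimage_void_event a b (J : {fset oedge S}) :
  jump_pattern a b @^-1` [set w | forall e, e \in J -> ~~ w e] =
  \bigcap_(e in [set` J]) ~` jumps e a b.
Proof.
rewrite eqEsubset; split=> K H e eJ.
  by move=> je; apply: je; apply/eqP; have := H e eJ; rewrite negbK.
by have /contrapT := H e eJ; rewrite /jump_pattern => ->; rewrite eqxx.
Qed.

Lemma measurable_jump_pattern a b : 0 <= a -> 0 <= b ->
  measurable_fun setT (jump_pattern a b).
Proof.
move=> a0 b0; apply: measurability; first reflexivity.
move=> _ [_ [J ->] <-]; rewrite setTI preimage_void_event.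
by apply: fin_bigcap_measurable => // e _; apply: measurableC; exact: measurable_jumps.
Qed.

(** The law of a random set of edges is determined by the probabilities that it avoids
    given finite sets; here these depend on the length of the time interval only. *)
Lemma jump_pattern_stationary a b a' b' (A : set (g_sigma_algebraType (@void_events S))) :
  0 <= a -> a <= b -> 0 <= a' -> a' <= b' -> b - a = b' - a' -> measurable A ->
  P (jump_pattern a b @^-1` A) = P (jump_pattern a' b' @^-1` A).
Proof.
move=> a0 ab a'0 ab' e mA.
have m1 := measurable_jump_pattern a0 (le_trans a0 ab).
have m2 := measurable_jump_pattern a'0 (le_trans a'0 ab').
pose mu1 := measure_function_pushforward__canonical__measure_function_Measure P m1.
pose mu2 := measure_function_pushforward__canonical__measure_function_Measure P m2.
change (mu1 A = mu2 A).
have := @measure_unique _ R (g_sigma_algebraType (@void_events S)) (@void_events S)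
  (fun=> setT) erefl (@setI_closed_void_events S) _ _ mu1 mu2.
apply => //.
- by move=> _; exists fset0; apply/seteqP; split.
- by rewrite bigcup_const//; exists 0%N.
- move=> _ [J ->]; rewrite /mu1 /mu2 /= /pushforward !preimage_void_event.
  by rewrite !(no_jumps_prob hc hP)// e.
- by move=> _; rewrite /mu1/= /pushforward preimage_setT probability_setT ltry.
Qed.

Lemma jump_graph_pattern (K : T) a b : regular K -> 0 <= a -> a <= b ->
  jump_graph K a b =2 pattern_graph (jump_pattern a b K).
Proof.
move=> Kr a0 ab x y.
have mono u v : (Kpath K u v a <= Kpath K u v b)%N.
  by rewrite /Kpath; case: insubP => // e _ _; have [Km _] := Kr e; exact: Km.
have markedE u v : marked (jump_pattern a b K) (u, v) = (Kpath K u v a < Kpath K u v b)%N.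
  rewrite ltn_neqAle mono andbT /marked /Kpath.
  by case: insubP => [e _ _|_]; rewrite ?eqxx// eq_sym.
rewrite /pattern_graph !markedE /jump_graph /Ksym.
by have := mono x y; have := mono y x; lia.
Qed.

(** Finiteness of the components of the graph of the step [r] depends on the set of
    edges that jump during the step, whose law is that of the first step. *)
Lemma step_components_finite_ae t0 r : assumption_SEP P t0 ->
  {ae P, forall K : borel T, finite_components (step_graph t0 K r)}.
Proof.
move=> [t0_gt0 hSEP].
have t00 := ltW t0_gt0.
pose F := [set w : g_sigma_algebraType (@void_events S) | finite_components (pattern_graph w)].
have mF : measurable F by exact: measurable_finite_components.
have finE a b (K : T) : regular K -> 0 <= a -> a <= b ->
    finite_components (jump_graph K a b) <-> F (jump_pattern a b K).
  move=> Kr a0 ab; rewrite /F /=.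
  have -> // : jump_graph K a b = pattern_graph (jump_pattern a b K).
  by apply/funext => x; apply/funext => y; exact: jump_graph_pattern.
have r0 : 0 <= r%:R * t0 by rewrite mulr_ge0.
have rr : r%:R * t0 <= r.+1%:R * t0 by rewrite ler_wpM2r// ler_nat.
have mpre a b : 0 <= a -> 0 <= b -> measurable (jump_pattern a b @^-1` F).
  by move=> a0 b0; rewrite -[X in measurable X]setTI; exact: measurable_jump_pattern.
have P1 : P (jump_pattern (r%:R * t0) (r.+1%:R * t0) @^-1` F) = 1%E.
  rewrite (@jump_pattern_stationary _ _ 0 t0)//; last by ring.
  have : {ae P, forall K : borel T, F (jump_pattern 0 t0 K)}.
    have h1 : {ae P, forall K : borel T, regular K} := regular_ae hP.
    have h2 : {ae P, forall K : borel T, finite_components (jump_graph K 0 t0)} := hSEP.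
    have H (K : borel T) : regular K -> finite_components (jump_graph K 0 t0) -> F (jump_pattern 0 t0 K).
      by move=> Kr /finE; apply.
    exact: filterS2 H h1 h2.
  have mc : measurable (~` (jump_pattern 0 t0 @^-1` F)) by apply: measurableC; exact: mpre.
  move=> /(negligibleP P mc).1 h.
  by rewrite -[X in P X]setCK probability_setC// h sube0.
have h1 : {ae P, forall K : borel T, regular K} := regular_ae hP.
have h2 : {ae P, forall K : borel T, F (jump_pattern (r%:R * t0) (r.+1%:R * t0) K)}.
  apply: (ae_probability1 (A := jump_pattern (r%:R * t0) (r.+1%:R * t0) @^-1` F)) => //.
  by apply: mpre => //; exact: le_trans rr.
have H (K : borel T) : regular K -> F (jump_pattern (r%:R * t0) (r.+1%:R * t0) K) ->
    finite_components (step_graph t0 K r).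
  by move=> Kr /finE; apply.
exact: filterS2 H h1 h2.
Qed.

Lemma summable_degrees_ae x : (\esum_(e in [set e : oedge S | touches e x]) (rate c e)%:E < +oo)%E ->
  {ae P, forall K : borel T, forall t, 0 <= t ->
    (\esum_(y in [set y | y != x]) (Ksym K x y t)%:R%:E < +oo :> \bar R)%E}.
Proof.
move=> Dfin.
have h1 : {ae P, forall K : borel T, regular K} := regular_ae hP.
have h2 := finite_jumping_edges_ae hc hP Dfin.
apply: (ae_imply2 h1 h2) => K Kr Kfin t t0.
apply: esum_finite_support => [y|]; first by rewrite lee_fin ler0n ltry.
have [N tN] : exists N : nat, t <= N%:R by exists (Num.truncn t).+1; rewrite ltW// truncnS_gt.
have := finite_image (fun e : oedge S => (val e).1) (Kfin N).
have := finite_image (fun e : oedge S => (val e).2) (Kfin N).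
move=> f2 f1; have := conj f1 f2; rewrite -finite_setU; apply: sub_finite_set => y [/= yx].
have pos u v : (0 < Kpath K u v t)%N -> exists2 e : oedge S, val e = (u, v) & K e N%:R <> K e 0.
  rewrite /Kpath; case: insubP => // e _ <-; have [Km K0] := Kr e.
  move=> Ket; exists e => //; rewrite K0 => KN; have := Km _ _ t0 tN.
  by rewrite KN leqNgt Ket.
rewrite eqe pnatr_eq0 -lt0n /Ksym addn_gt0 => /orP[/pos[e eE je]|/pos[e eE je]].
- by right; exists e; rewrite ?eE//; split=> //; rewrite /touches eE eqxx.
- by left; exists e; rewrite ?eE//; split=> //; rewrite /touches eE eqxx orbT.
Qed.

(** The summability of the rates at each vertex gives the summability of the degrees, and
    stationarity carries the finiteness of the components over to all time steps. *)
Lemma Gamma_star_ae t0 : assumption_SEP P t0 ->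
  {ae P, forall K : borel T, Gamma_star t0 K}.
Proof.
move=> hSEP.
have h1 : {ae P, forall K : borel T, forall r : nat, finite_components (step_graph t0 K r)}.
  by apply: ae_forall_countable => r; exact: step_components_finite_ae.
have h2 : {ae P, forall K : borel T, forall x t, 0 <= t ->
    (\esum_(y in [set y | y != x]) (Ksym K x y t)%:R%:E < +oo :> \bar R)%E}.
  by apply: ae_forall_countable => x; apply: summable_degrees_ae; exact: rate_sum_finite hSEP.
have h3 : {ae P, forall K : borel T, forall e e' : oedge S, e != e' ->
    jump_times (K e) `&` jump_times (K e') = set0}.
  apply: ae_forall_countable => e; apply: ae_forall_countable => e'.
  have [->|ee'] := eqVneq e e'; first by apply: aeW => K.
  by apply: filterS (disjoint_jump_times_ae hc hP ee').
have h4 : {ae P, forall K : borel T, forall (e : oedge S) t, jump_times (K e) t ->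
    K e t = (left_lim (K e) t).+1}.
  by apply: ae_forall_countable => e; exact: (jumps_by_one_ae hc hP).
have h5 : {ae P, forall K : borel T, regular K} := regular_ae hP.
have h34 : {ae P, forall K : borel T, (forall e e' : oedge S, e != e' ->
    jump_times (K e) `&` jump_times (K e') = set0) /\ (forall (e : oedge S) t, jump_times (K e) t ->
    K e t = (left_lim (K e) t).+1)}.
  by apply: (ae_imply2 h3 h4).
have h12 : {ae P, forall K : borel T, (forall r : nat, finite_components (step_graph t0 K r)) /\
    forall x t, 0 <= t ->
    (\esum_(y in [set y | y != x]) (Ksym K x y t)%:R%:E < +oo :> \bar R)%E}.
  by apply: (ae_imply2 h1 h2).
have h345 := ae_imply2 h34 h5 (fun K => @conj _ _).
apply: (ae_imply2 h12 h345) => K [? ?] [[? ?] Kr]; split=> // e.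
by have [] := Kr e.
Qed.

End stationarity.

(** * Integrals of bounded functions that differ on a small event *)

Section integral_perturbation.
Context d (T : measurableType d) (R : realType) (P : probability T R).
Import HBNNSimple.

(** The integral of a nonnegative function, measurable or not, is the supremum of the
    integrals of the simple functions below it; and a simple function below [f], once
    replaced by 0 on [E], is below [g]. *)
Lemma ge0_integral_perturb (E : set T) (f g : T -> R) (M : R) : measurable E ->
  0 <= M -> (forall w, 0 <= f w <= M) -> (forall w, 0 <= g w) ->
  (forall w, ~ E w -> f w = g w) ->
  (\int[P]_w (f w)%:E <= \int[P]_w (g w)%:E + M%:E * P E)%E.
Proof.
move=> mE M0 fM g0 fg.
rewrite [leLHS]ge0_integralTE; last by move=> w; rewrite lee_fin; case/andP: (fM w).
apply: ge_ereal_sup => _ [h /= hf <-].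
rewrite -integralT_nnsfun.
have mEc : measurable (~` E) by exact: measurableC.
rewrite -(setvU E) ge0_integral_setU//=; last 3 first.
- by rewrite setvU; apply/measurable_EFinP; exact: measurable_funP.
- by move=> w _; rewrite lee_fin.
- by apply/disj_setPS => w [].
apply: leeD.
  rewrite setvU integral_nnsfun// [leRHS]ge0_integralTE; last by move=> w; rewrite lee_fin.
  apply: ereal_sup_ubound; exists (proj_nnsfun h mEc); last first.
    by rewrite (mrestrict h mEc).
  move=> w; rewrite /= mindicE.
  have [|wE] := boolP (w \in ~` E); last by rewrite mulr0 lee_fin.
  by rewrite inE => /fg <-; rewrite mulr1.
rewrite -integral_cst//; apply: ge0_le_integral => //.
- by move=> w _; rewrite lee_fin.
- by apply/measurable_EFinP; exact: measurable_funTS.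
- by move=> w _; rewrite (le_trans (hf w))// lee_fin; case/andP: (fM w).
Qed.

(** This evaluates the semigroup without a study of the measurability of the configuration
    [eta t0 K sigma t] in [K]: the domain [D] is [Gamma_star t0], and [g] is a combination
    of indicators of jump events. *)
Lemma Rintegral_perturb (D E : set T) (f g : T -> R) (M : R) : measurable E ->
  (forall w, `|f w| <= M) -> (forall w, `|g w| <= M) ->
  (forall w, ~ E w -> D w /\ f w = g w) ->
  `|Rintegral P D f - Rintegral P setT g| <= 2 * M * fine (P E).
Proof.
move=> mE fM gM fg.
have M0 : 0 <= M by rewrite (le_trans _ (fM point)).
have PE : P E = (fine (P E))%:E by rewrite fineK// fin_num_measure.
set p := fine (P E) in PE *.
pose F := f \_ D.
have FM w : `|F w| <= M by rewrite /F /patch; case: ifP; rewrite ?normr0.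
have Fg w : ~ E w -> F w = g w.
  by move=> /fg[Dw fgw]; rewrite /F /patch mem_set.
have bnd (u : T -> R) : (forall w, `|u w| <= M) -> forall w, 0 <= u^\+%R w <= M /\ 0 <= u^\-%R w <= M.
  move=> uM w; rewrite funrpos_ge0 funrneg_ge0 /funrpos /funrneg !ge_max M0 !andbT.
  by move: (uM w); rewrite ler_norml => /andP[]; lra.
have key (u v : T -> R) : (forall w, `|u w| <= M) -> (forall w, `|v w| <= M) ->
    (forall w, ~ E w -> u w = v w) ->
    ((\int[P]_w (u^\+%R w)%:E <= \int[P]_w (v^\+%R w)%:E + (M * p)%:E) /\
    (\int[P]_w (u^\-%R w)%:E <= \int[P]_w (v^\-%R w)%:E + (M * p)%:E))%E.
  move=> uM vM uv; rewrite EFinM -PE; split; apply: ge0_integral_perturb => //.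
  - by move=> w; case: (bnd u uM w).
  - by move=> w /uv; rewrite /funrpos => ->.
  - by move=> w; case: (bnd u uM w).
  - by move=> w /uv; rewrite /funrneg => ->.
have fin (u : T -> R) : (forall w, 0 <= u w <= M) -> (\int[P]_w (u w)%:E)%E \is a fin_num.
  move=> uM; rewrite ge0_fin_numE; last by apply: integral_ge0 => w _; rewrite lee_fin; case/andP: (uM w).
  have := ge0_integral_perturb measurableT M0 uM (fun=> lexx 0) (fun w nT => False_ind _ (nT Logic.I)).
  rewrite integral0 add0e => /le_lt_trans; apply.
  by rewrite probability_setT mule1 ltry.
have RE (u : T -> R) : (forall w, `|u w| <= M) -> Rintegral P setT u =
    fine (\int[P]_w (u^\+%R w)%:E) - fine (\int[P]_w (u^\-%R w)%:E).
  move=> uM; rewrite /Rintegral integralE.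
  rewrite -[fun w => (u w)%:E]/(EFin \o u) funerpos funerneg fineB//.
  - by apply: fin => w; case: (bnd u uM w).
  - by apply: fin => w; case: (bnd u uM w).
rewrite Rintegral_mkcond -/F !RE//.
have [k1 k2] := key _ _ FM gM Fg.
have [k3 k4] := key _ _ gM FM (fun w Ew => esym (Fg w Ew)).
move: k1 k2 k3 k4.
have f1 : (\int[P]_w (F^\+%R w)%:E)%E \is a fin_num by apply: fin => w; case: (bnd _ FM w).
have f2 : (\int[P]_w (F^\-%R w)%:E)%E \is a fin_num by apply: fin => w; case: (bnd _ FM w).
have g1 : (\int[P]_w (g^\+%R w)%:E)%E \is a fin_num by apply: fin => w; case: (bnd _ gM w).
have g2 : (\int[P]_w (g^\-%R w)%:E)%E \is a fin_num by apply: fin => w; case: (bnd _ gM w).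
rewrite -(fineK f1) -(fineK f2) -(fineK g1) -(fineK g2) -!EFinD !lee_fin /= => *.
by rewrite ler_norml; apply/andP; split; lra.
Qed.

Lemma Rintegral_indic_comb (I : choiceType) (F : seq I) (a0 : R) (a : I -> R) (A : I -> set T) :
  (forall i, measurable (A i)) ->
  Rintegral P setT (fun w => a0 + \sum_(i <- F) a i * \1_(A i) w) =
  a0 + \sum_(i <- F) a i * fine (P (A i)).
Proof.
move=> mA.
have int1 i : P.-integrable setT (EFin \o (fun w => a i * \1_(A i) w)).
  have -> : EFin \o (fun w => a i * \1_(A i) w) = (fun w => (a i)%:E * (\1_(A i) w)%:E)%E.
    by apply/funext => w /=; rewrite EFinM.
  by apply: integrableZl => //; exact: integrable_indic.
have intS s : P.-integrable setT (EFin \o (fun w => \sum_(i <- s) a i * \1_(A i) w)).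
  have -> : EFin \o (fun w => \sum_(i <- s) a i * \1_(A i) w) =
      (fun w => \sum_(i <- s) (a i * \1_(A i) w)%:E)%E.
    by apply/funext => w /=; rewrite sumEFin.
  by apply: integrable_sum => // i _; exact: int1.
have intc : P.-integrable setT (EFin \o cst a0) by apply: finite_measure_integrable_cst.
rewrite (RintegralD measurableT intc (intS F)).
congr (_ + _).
  rewrite Rintegral_cst// -[RHS]mulr1; congr (_ * _).
  by rewrite -[1]/(fine 1%E); congr fine; exact: probability_setT.
elim: F => [|i F IH].
  by rewrite big_nil -[RHS](mul0r (fine (P setT))) -Rintegral_cst//; apply: eq_Rintegral => w _; rewrite big_nil.
rewrite big_cons -IH (_ : a i * fine (P (A i)) = Rintegral P setT (fun w => a i * \1_(A i) w)).
  by rewrite -RintegralD//; apply: eq_Rintegral => w _; rewrite big_cons.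
rewrite RintegralZl//; last exact: integrable_indic.
by rewrite /Rintegral integral_indic// setIT.
Qed.

End integral_perturbation.

(** * Iterated and unordered sums *)

#[local] Existing Instance summability.totally_filter.

Section unordered_sums.
Variable R : realType.

Lemma fine_esum_fset (I : choiceType) (u : I -> R) (J : {fset I}) : (forall i, 0 <= u i) ->
  (\esum_(i in [set: I]) (u i)%:E < +oo)%E ->
  fine (\esum_(i in [set: I]) (u i)%:E) =
  \sum_(i <- J) u i + fine (\esum_(i in ~` [set` J]) (u i)%:E).
Proof.
move=> u0 ufin.
have e0 (D : set I) : (0 <= \esum_(i in D) (u i)%:E)%E.
  by apply: esum_ge0 => i _; rewrite lee_fin.
have E : (\esum_(i in [set: I]) (u i)%:E = (\sum_(i <- J) u i)%:E + \esum_(i in ~` [set` J]) (u i)%:E)%E.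
  rewrite (esumID [set` J]); last by move=> i _; rewrite lee_fin.
  rewrite !setTI esum_fset//; last by move=> i _; rewrite lee_fin.
  by rewrite fsbig_finite//= set_fsetK sumEFin.
have f1 : (\esum_(i in ~` [set` J]) (u i)%:E)%E \is a fin_num.
  rewrite ge0_fin_numE//; move: ufin; rewrite E; apply: le_lt_trans.
  by rewrite leeDr// lee_fin sumr_ge0.
by rewrite E fineD.
Qed.

(** Stated for an arbitrary decomposition into summable nonnegative families, and not
    for the positive and negative parts, because it is applied to the row sums of an
    iterated series, which come as differences of the row sums of both parts. *)
Lemma series_sum_diff (I : choiceType) (u v : I -> R) :
  (forall i, 0 <= u i) -> (forall i, 0 <= v i) ->
  (\esum_(i in [set: I]) (u i)%:E < +oo)%E -> (\esum_(i in [set: I]) (v i)%:E < +oo)%E ->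
  series_sum (fun i => u i - v i) =
  fine (\esum_(i in [set: I]) (u i)%:E) - fine (\esum_(i in [set: I]) (v i)%:E).
Proof.
move=> u0 v0 ufin vfin.
apply: (@cvg_lim R^o) => //; apply/(@cvgrPdist_le R R^o) => eps eps0.
have eps2 : 0 < eps / 2 by rewrite divr_gt0.
have [F1 [_ H1]] := esum_tail (fun i _ => u0 i : (0 <= (u i)%:E)%E) ufin eps2.
have [F2 [_ H2]] := esum_tail (fun i _ => v0 i : (0 <= (v i)%:E)%E) vfin eps2.
exists (F1 `|` F2)%fset => // J /= FJ.
rewrite /summability.partial_sum.
have -> : \sum_(i : J) (u (val i) - v (val i)) = \sum_(i <- J) (u i - v i).
  by rewrite [RHS]big_seq_fsetE.
rewrite sumrB.
rewrite (fine_esum_fset J u0 ufin) (fine_esum_fset J v0 vfin).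
have tail (w : I -> R) (F : {fset I}) : (forall i, 0 <= w i) -> (F `<=` J)%fset ->
    (\esum_(i in [set: I] `\` [set` F]) (w i)%:E <= (eps / 2)%:E)%E ->
    0 <= fine (\esum_(i in ~` [set` J]) (w i)%:E) <= eps / 2.
  move=> w0 FJ' H.
  have le : (\esum_(i in ~` [set` J]) (w i)%:E <= (eps / 2)%:E)%E.
    apply: le_trans H; rewrite esum_mkcond [leRHS]esum_mkcond; apply: le_esum => i _.
    case: ifPn => [/set_mem iJ|_]; last by case: ifP => // _; rewrite lee_fin.
    by rewrite mem_set//; split=> // /(fsubsetP FJ').
  have ge : (0 <= \esum_(i in ~` [set` J]) (w i)%:E)%E by apply: esum_ge0 => i _; rewrite lee_fin.
  rewrite fine_ge0//= -lee_fin fineK//.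
  by rewrite ge0_fin_numE// (le_lt_trans le)// ltry.
have /andP[a1 a2] := tail u F1 u0 (fsubset_trans (fsubsetUl _ _) FJ) H1.
have /andP[b1 b2] := tail v F2 v0 (fsubset_trans (fsubsetUr _ _) FJ) H2.
rewrite ler_norml; apply/andP; split; lra.
Qed.

(** By the theorem of Tonelli for the positive and negative parts, the iterated sum is the
    unordered sum over pairs, and the pairs outside [F] contribute at most the sum of
    their bounds. *)
Lemma iterated_series_sum (I J : choiceType) (G b : I -> J -> R) (F : {fset I * J}) :
  (forall i j, `|G i j| <= b i j) ->
  (\esum_(p in [set: I * J]) (b p.1 p.2)%:E < +oo)%E ->
  `|series_sum (fun i => series_sum (G i)) - \sum_(p <- F) G p.1 p.2| <=
  fine (\esum_(p in ~` [set` F]) (b p.1 p.2)%:E).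
Proof.
move=> Gb bfin.
pose u i j := Num.max (G i j) 0; pose v i j := Num.max (- G i j) 0.
have u0 i j : 0 <= u i j by rewrite le_max lexx orbT.
have v0 i j : 0 <= v i j by rewrite le_max lexx orbT.
have uv i j : G i j = u i j - v i j.
  by rewrite /u /v /Order.max; case: (ltP (G i j) 0) => ?; case: (ltP (- G i j) 0) => ?; lra.
have uvb i j : u i j + v i j <= b i j.
  have := Gb i j; rewrite ler_norml /u /v /Order.max => /andP[].
  by case: (ltP (G i j) 0) => ?; case: (ltP (- G i j) 0) => ?; lra.
have ub i j : u i j <= b i j by rewrite (le_trans _ (uvb i j))// lerDl.
have vb i j : v i j <= b i j by rewrite (le_trans _ (uvb i j))// lerDr.
have iter (w : I -> J -> R) : (forall i j, 0 <= w i j) -> (forall i j, w i j <= b i j) ->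
    [/\ (\esum_(p in [set: I * J]) (w p.1 p.2)%:E < +oo)%E,
      forall i, (\esum_(j in [set: J]) (w i j)%:E < +oo)%E &
      (\esum_(i in [set: I]) (fine (\esum_(j in [set: J]) (w i j)%:E))%:E =
      \esum_(p in [set: I * J]) (w p.1 p.2)%:E)%E].
  move=> w0 wb.
  have wfin : (\esum_(p in [set: I * J]) (w p.1 p.2)%:E < +oo)%E.
    by apply: le_lt_trans bfin; apply: le_esum => p _; rewrite lee_fin.
  have E : (\esum_(i in [set: I]) \esum_(j in [set: J]) (w i j)%:E =
      \esum_(p in [set: I * J]) (w p.1 p.2)%:E)%E.
    rewrite esum_esum; last by move=> i j _ _; rewrite lee_fin.
    by congr esum; apply/seteqP; split.
  have rowfin i : (\esum_(j in [set: J]) (w i j)%:E < +oo)%E.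
    apply: le_lt_trans wfin; rewrite -E.
    rewrite -(@esum_set1 _ _ i (fun i => \esum_(j in [set: J]) (w i j)%:E)%E); last first.
      by apply: esum_ge0 => j _; rewrite lee_fin.
    rewrite esum_mkcond [leRHS]esum_mkcond; apply: le_esum => i' _.
    case: ifP => _; rewrite in_setT// esum_ge0// => j _; rewrite lee_fin//.
  split=> //; rewrite -E; apply: eq_esum => i _; rewrite fineK// ge0_fin_numE// esum_ge0// => j _.
  by rewrite lee_fin.
have [uf ur uE] := iter u u0 ub; have [vf vr vE] := iter v v0 vb.
have row i : series_sum (G i) = fine (\esum_(j in [set: J]) (u i j)%:E) -
    fine (\esum_(j in [set: J]) (v i j)%:E).
  rewrite -series_sum_diff//; congr series_sum; apply/funext => j; exact: uv.
have -> : series_sum (fun i => series_sum (G i)) =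
  fine (\esum_(p in [set: I * J]) (u p.1 p.2)%:E) - fine (\esum_(p in [set: I * J]) (v p.1 p.2)%:E).
  rewrite -uE -vE -series_sum_diff ?uE ?vE//.
  - by congr series_sum; apply/funext => i; exact: row.
  - by move=> i; apply: fine_ge0; apply: esum_ge0 => j _; rewrite lee_fin.
  - by move=> i; apply: fine_ge0; apply: esum_ge0 => j _; rewrite lee_fin.
rewrite (fine_esum_fset F (fun p => u0 p.1 p.2) uf) (fine_esum_fset F (fun p => v0 p.1 p.2) vf).
have -> : \sum_(p <- F) G p.1 p.2 = \sum_(p <- F) u p.1 p.2 - \sum_(p <- F) v p.1 p.2.
  by rewrite -sumrB; apply: eq_bigr => p _; exact: uv.
set U := \esum_(p in ~` _) (u _ _)%:E; set V := \esum_(p in ~` _) (v _ _)%:E.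
set B := \esum_(p in _) _.
have b0 i j : 0 <= b i j by exact: le_trans (normr_ge0 _) (Gb i j).
have [U0 V0 B0] : [/\ 0 <= U, 0 <= V & 0 <= B]%E.
  by split; apply: esum_ge0 => p _; rewrite lee_fin.
have UVB : (U + V <= B)%E.
  rewrite /U /V -esumD; try by move=> p _; rewrite lee_fin.
  by apply: le_esum => p _; rewrite -EFinD lee_fin.
have Bfin : B \is a fin_num.
  rewrite ge0_fin_numE// (le_lt_trans _ bfin)// /B esum_mkcond.
  by apply: le_esum => p _; case: ifP => // _; rewrite lee_fin.
have Ufin : U \is a fin_num.
  rewrite ge0_fin_numE//; apply: (le_lt_trans (y := B)); last by rewrite -ge0_fin_numE.
  by rewrite (le_trans _ UVB)// leeDl.
have Vfin : V \is a fin_num.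
  rewrite ge0_fin_numE//; apply: (le_lt_trans (y := B)); last by rewrite -ge0_fin_numE.
  by rewrite (le_trans _ UVB)// leeDr.
have h : fine U + fine V <= fine B by rewrite -fineD// fine_le// fin_numD Ufin.
have := fine_ge0 U0; have := fine_ge0 V0.
by rewrite ler_norml => *; apply/andP; split; lra.
Qed.

End unordered_sums.

(** * Local functions and the terms of the generator *)

Section local_functions.
Variables (R : realType) (S : countType).
Implicit Types (f g : config S -> R) (xi zeta sigma : config S) (A : {fset S}).

Definition supported_on A f := forall xi zeta, {in A, xi =1 zeta} -> f xi = f zeta.

Lemma near_agree A xi : \forall zeta \near xi, {in A, xi =1 zeta}.
Proof.
have near1 x : \forall zeta \near xi, zeta x = xi x.
  have := @proj_continuous S (fun=> bool) x xi.
  by move=> /(_ [set b | b = xi x]); apply.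
have h := @filter_bigI _ _ A (fun x => [set zeta : config S | zeta x = xi x]) (nbhs xi)
  (nbhs_filter xi) (fun x _ => near1 x).
by apply: (@filterS _ (nbhs xi) (nbhs_filter xi) _ _ _ h) => zeta H x xA; rewrite (H x xA).
Qed.

Lemma continuous_local f : local_function f -> continuous f.
Proof.
move=> [A fA] xi U /nbhs_singleton Ufxi.
by apply: (@filterS _ (nbhs xi) (nbhs_filter xi) _ _ _ (near_agree A xi)) => zeta H /=; rewrite -(fA _ _ H).
Qed.

(** A local function takes finitely many values, one for each configuration on [A]. *)
Lemma bounded_local f : local_function f -> exists2 M, 0 <= M & forall xi, `|f xi| <= M.
Proof.
move=> [A fA].
pose ext (w : {ffun A -> bool}) : config S :=
  fun x => if insub x is Some a then w a else false.
pose res (xi : config S) : {ffun A -> bool} := [ffun a => xi (val a)].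
have fE xi : f xi = f (ext (res xi)).
  apply: fA => x xA; rewrite /ext insubT /= ffunE//.
exists (\sum_(w : {ffun A -> bool}) `|f (ext w)|); first by apply: sumr_ge0.
by move=> xi; rewrite fE (bigD1 (res xi))//= lerDl sumr_ge0.
Qed.

Lemma exchange_off A xi x y : x \notin A -> y \notin A -> {in A, exchange xi x y =1 xi}.
Proof.
move=> xA yA z zA; rewrite /exchange; case: eqP => [zx|_]; first by rewrite -zx zA in xA.
by case: eqP => [zy|_] //; rewrite -zy zA in yA.
Qed.

Variable c : S -> S -> R.
Hypotheses (hc : forall x y, 0 <= c x y) (hc0 : forall x, c x x = 0).

Lemma generator_term_supported A f x y : supported_on A f ->
  supported_on (x |` (y |` A))%fset (generator_term c f x y).
Proof.
move=> fA xi zeta H.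
have Hx : xi x = zeta x by apply: H; rewrite !inE eqxx.
have Hy : xi y = zeta y by apply: H; rewrite !inE eqxx orbT.
have HA : {in A, xi =1 zeta} by move=> z zA; apply: H; rewrite !inE zA !orbT.
rewrite /generator_term Hx Hy (fA _ _ HA); congr (_ * (_ - _)); apply: fA => z zA.
by rewrite /exchange Hx Hy HA.
Qed.

(** An exchange of two sites outside [A] leaves a function supported on [A] unchanged,
    so only the pairs that meet [A] contribute to its generator. *)
Definition term_bound A (M : R) (p : S * S) : R :=
  if (p.1 \in A) || (p.2 \in A) then 2 * M * c p.1 p.2 else 0.

Lemma generator_term_le A f M x y xi : supported_on A f -> (forall xi, `|f xi| <= M) ->
  `|generator_term c f x y xi| <= term_bound A M (x, y).
Proof.
move=> fA fM; rewrite /term_bound/=; have [xyA|] := ifPn; last first.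
  rewrite negb_or => /andP[xA yA].
  by rewrite /generator_term (fA _ _ (exchange_off xi xA yA)) subrr mulr0 normr0.
rewrite /generator_term !normrM (ger0_norm (hc x y)) [2 * M * _]mulrC.
have h1 : `|f (exchange xi x y) - f xi| <= 2 * M.
  by rewrite (le_trans (ler_normB _ _))// mulr2n mulrDl !mul1r lerD.
have [h2 h3] : `|(xi x)%:R| <= 1 :> R /\ `|1 - (xi y)%:R| <= 1 :> R.
  by split; [case: (xi x)|case: (xi y)]; rewrite ?subrr ?subr0 ?normr0 ?normr1.
apply: ler_pM => //; rewrite ?mulr_ge0//.
rewrite -[leRHS]mulr1; apply: ler_pM; rewrite ?mulr_ge0//.
by rewrite -[leRHS]mulr1; apply: ler_pM.
Qed.

Lemma term_bound_ge0 A M p : 0 <= M -> 0 <= term_bound A M p.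
Proof. by move=> M0; rewrite /term_bound; case: ifP => // _; rewrite !mulr_ge0. Qed.

Definition edges_at A : set (oedge S) := [set e | ((val e).1 \in A) || ((val e).2 \in A)].

(** The pairs with a nonzero bound are edges that meet [A], as the rates vanish on the
    diagonal. *)
Lemma term_bound_tail A M (F : {fset oedge S}) : 0 <= M ->
  (\esum_(p in ~` [set` (val @` F)%fset]) (term_bound A M p)%:E <=
   (2 * M)%:E * \esum_(e in edges_at A `\` [set` F]) (rate c e)%:E)%E.
Proof.
move=> M0.
have b0 p : (0 <= (term_bound A M p)%:E)%E by rewrite lee_fin term_bound_ge0.
apply: (@le_trans _ _ (\esum_(p in val @` (edges_at A `\` [set` F])) (term_bound A M p)%:E)%E).
  rewrite esum_mkcond [leRHS]esum_mkcond; apply: le_esum => p _.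
  case: ifPn => [/set_mem/= pF|_]; last by case: ifP.
  case: ifPn => // /negP pD; rewrite lee_fin /term_bound.
  have [pA|//] := ifPn; have [p12|p12] := eqVneq p.1 p.2.
    by rewrite p12 hc0 mulr0.
  exfalso; apply: pD; apply: mem_set; exists (exist _ p p12) => //; split=> //=.
  by move=> eF; apply: pF; apply/imfsetP; exists (exist _ p p12).
rewrite esum_image; last by move=> e e' _ _ /val_inj.
apply: le_trans (esumZ_le _ _ _); last 2 first.
- by rewrite mulr_ge0.
- by move=> e; rewrite lee_fin /rate.
apply: le_esum => e [eA _]; rewrite /term_bound eA -EFinM lee_fin.
by [].
Qed.

Lemma edges_at_rate_finite A :
  (forall x, (\esum_(e in [set e : oedge S | touches e x]) (rate c e)%:E < +oo)%E) ->
  (\esum_(e in edges_at A) (rate c e)%:E < +oo)%E.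
Proof.
move=> H.
have r0 e : (0 <= (rate c e)%:E)%E by rewrite lee_fin /rate.
apply: (@le_lt_trans _ _ (\sum_(x <- A) \esum_(e in [set e : oedge S | touches e x]) (rate c e)%:E)%E); last first.
  by apply: lte_sum_pinfty => x _; exact: H.
under eq_bigr do rewrite esum_mkcond.
rewrite -esum_sum; last by move=> i j _ _; case: ifP.
rewrite esum_mkcond; apply: le_esum => e _; case: ifPn => [/set_mem eA|_]; last first.
  by apply: sume_ge0 => x _; case: ifP.
have [x xA ex] : exists2 x, x \in A & touches e x.
  by case/orP: eA => ?; [exists (val e).1|exists (val e).2] => //; rewrite /touches eqxx ?orbT.
rewrite (bigD1_seq x)//= mem_set// leeDl// sume_ge0// => y _; by case: ifP.
Qed.

End local_functions.

(** * First-order expansion of the dynamics *)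

Section one_jump_expansion.
Variables (R : realType) (S : countType).
Implicit Types (f : config S -> R) (sigma : config S) (A : {fset S}) (e : oedge S)
  (F : {fset oedge S}) (t : R) (K : borel (path_family R S)).

(** The edges whose jumps could interfere, on [A], with a jump along [e]. *)
Definition neighbours A e : set (oedge S) :=
  [set e' | e' != e /\ edges_at ((val e).1 |` ((val e).2 |` A))%fset e'].

Definition far_jump A F t : set (borel (path_family R S)) :=
  \bigcup_(e in edges_at A `\` [set` F]) jumps e 0 t.

(** An event of probability of order [t ^ 2] for fixed [F]. *)
Definition double_jump A F t : set (borel (path_family R S)) :=
  \bigcup_(e in [set` F]) (jumps_again e 0 t `|`
    \bigcup_(e' in neighbours A e) (jumps e 0 t `&` jumps e' 0 t)).

Definition gain f sigma e : R := f (jump_along e sigma) - f sigma.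

(** The value of [f] at time [t] if the jumps of the edges of [F] contributed additively;
    its expectation is explicit. *)
Definition first_order f sigma F t K : R :=
  f sigma + \sum_(e <- F) gain f sigma e * \1_(jumps e 0 t) K.

Lemma rate_gain (c : S -> S -> R) f sigma e :
  rate c e * gain f sigma e = generator_term c f (val e).1 (val e).2 sigma.
Proof.
rewrite /gain /jump_along /generator_term /rate -!mulrA; congr (_ * _).
by case: (sigma (val e).1); case: (sigma (val e).2); rewrite /= ?subrr ?subr0 ?mul0r ?mul1r ?mulr0.
Qed.

Lemma edges_at_touches A e z : touches e z -> z \in A -> edges_at A e.
Proof. by rewrite /touches /edges_at/= => /orP[]/eqP <- ->; rewrite ?orbT. Qed.

Lemma first_order_cases A F f sigma t K : [set` F] `<=` edges_at A ->
  ~ double_jump A F t K ->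
  ((forall e, e \in F -> ~ jumps e 0 t K) /\ first_order f sigma F t K = f sigma) \/
  exists e, [/\ e \in F, K e t = (K e 0).+1,
    forall e', neighbours A e e' -> ~ jumps e' 0 t K &
    first_order f sigma F t K = f (jump_along e sigma)].
Proof.
move=> FA nd.
have [[e [eF je]]|nj] := pselect (exists e, e \in F /\ jumps e 0 t K); last first.
  left; have nj' e : e \in F -> ~ jumps e 0 t K by move=> eF je; apply: nj; exists e.
  split=> //; rewrite /first_order big_seq big1 ?addr0// => e eF.
  by rewrite indicE memNset ?mulr0//; exact: nj'.
right; exists e.
have nb e' : neighbours A e e' -> ~ jumps e' 0 t K.
  by move=> ne' je'; apply: nd; exists e => //; right; exists e'.
split=> //.
  by apply: contrapT => ne; apply: nd; exists e => //; left.
rewrite /first_order (big_fsetD1 e)//= indicE mem_set// mulr1 big_seq big1 ?addr0.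
  by rewrite /gain addrC subrK.
move=> e'; rewrite !inE => /andP[e'e e'F].
rewrite indicE memNset ?mulr0//; apply: nb; split=> //.
by have := FA _ e'F; rewrite /edges_at/= !inE => /orP[] ->; rewrite ?orbT.
Qed.

(** Outside both exceptional events, either no edge that meets [A] jumps before time
    [t], or exactly one does, once, and no other edge that meets [A] or one of its ends
    does. *)
Lemma one_jump_expansion A F f sigma t0 t K : supported_on A f ->
  [set` F] `<=` edges_at A -> 0 <= t < t0 -> regular K -> Gamma_star t0 K ->
  ~ far_jump A F t K -> ~ double_jump A F t K ->
  f (eta t0 K sigma t) = first_order f sigma F t K.
Proof.
move=> fA FA /andP[t_ge0 tt0] Kr KG nfar ndouble.
have Kfin : finite_components (step_graph t0 K 0) by have [+ _ _ _ _] := KG; apply.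
have noj e : ~ jumps e 0 t K -> K e t = 0%N.
  by move=> /contrapT; have [_ ->] := Kr e.
have [[nj ->]|[e [eF Ke nb ->]]] := first_order_cases f sigma FA ndouble; apply: fA => z zA.
- apply: eta_quiet => // e ez; apply: noj => je.
  have [eF|eF] := boolP (e \in F); first exact: (nj e eF).
  apply: nfar; exists e => //; split; first exact: edges_at_touches zA.
  by move=> /= h; rewrite h in eF.
- have [_ K0] := Kr e; rewrite K0 in Ke.
  have [ez|ez] := boolP (touches e z).
    apply: eta_single_jump => // e' e'e e'uv; apply: noj; apply: nb; split=> //.
    by case/orP: e'uv => h; apply: edges_at_touches h _; rewrite !inE eqxx ?orbT.
  rewrite eta_quiet//.
    rewrite /jump_along /exchange; case: ifP => // _.
    by move: ez; rewrite /touches negb_or => /andP[/negbTE-> /negbTE->].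
  move=> e' e'z; apply: noj; apply: nb; split.
    by apply: contraNneq ez => <-.
  by apply: edges_at_touches e'z _; rewrite !inE zA !orbT.
Qed.

End one_jump_expansion.

(** * Probabilities of the exceptional events *)

Section rare_events.
Variables (R : realType) (S : countType).
Variables (c : S -> S -> R) (P : probability (borel (path_family R S)) R) (t0 : R).
Hypotheses (hc : forall x y, 0 <= c x y).
Hypotheses (hP : poisson_law c P) (hSEP : assumption_SEP P t0).
Implicit Types (f : config S -> R) (sigma : config S) (A : {fset S}) (e : oedge S)
  (F : {fset oedge S}) (t : R).

Let rate := rate c.
Let rate_ge0 e : (0 <= (rate e)%:E)%E. Proof. by rewrite lee_fin /rate rate_ge0. Qed.

(** This is where the assumption on the components enters the computation of the
    generator. *)
Lemma edges_at_rate_fin A : (\esum_(e in edges_at A) (rate e)%:E < +oo)%E.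
Proof. by apply: edges_at_rate_finite => // x; exact: rate_sum_finite hSEP. Qed.

Lemma far_jump_prob A F t : 0 <= t ->
  measurable (far_jump A F t) /\
  (P (far_jump A F t) <= t%:E * \esum_(e in edges_at A `\` [set` F]) (rate e)%:E)%E.
Proof.
move=> t_ge0.
have mJ e : measurable (jumps e 0 t : set (borel (path_family R S))) by exact: measurable_jumps.
have [m1 h1] := measure_bigcup_countable_le P (edges_at A `\` [set` F]) mJ.
split=> //; apply: (le_trans h1); apply: le_trans (esumZ_le _ t_ge0 rate_ge0).
apply: le_esum => e _; rewrite -EFinM mulrC.
by have := jumps_prob_le hc hP e (lexx 0) t_ge0; rewrite subr0.
Qed.

Definition double_rate A F : R :=
  \sum_(e <- F) (rate e ^+ 2 + rate e * fine (\esum_(e' in neighbours A e) (rate e')%:E)).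

Lemma double_rate_ge0 A F : 0 <= double_rate A F.
Proof.
apply: sumr_ge0 => e _; have re : 0 <= rate e by rewrite -lee_fin.
by rewrite addr_ge0 ?sqr_ge0// mulr_ge0// fine_ge0// esum_ge0.
Qed.

Lemma double_jump_prob A F t : 0 <= t ->
  measurable (double_jump A F t) /\ (P (double_jump A F t) <= (double_rate A F * t ^+ 2)%:E)%E.
Proof.
move=> t_ge0.
have mJ e : measurable (jumps e 0 t : set (borel (path_family R S))) by exact: measurable_jumps.
pose B e : set (borel (path_family R S)) :=
  \bigcup_(e' in neighbours A e) (jumps e 0 t `&` jumps e' 0 t).
have mB e : measurable (B e) /\
    (P (B e) <= (rate e * fine (\esum_(e' in neighbours A e) (rate e')%:E) * t ^+ 2)%:E)%E.
  have mJJ e' : measurable (jumps e 0 t `&` jumps e' 0 t : set (borel (path_family R S))).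
    exact: measurableI.
  have [m1 h1] := measure_bigcup_countable_le P (neighbours A e) mJJ.
  split=> //; apply: (le_trans h1).
  have re : 0 <= rate e by rewrite -lee_fin.
  apply: (@le_trans _ _ (\esum_(e' in neighbours A e) ((rate e * t ^+ 2)%:E * (rate e')%:E))%E).
    apply: le_esum => e' [e'e _]; rewrite -EFinM.
    have := two_jumps_prob_le hc hP (s := 0) (t := t) (e := e) (e' := e').
    by rewrite eq_sym e'e subr0 mulrAC => /(_ isT (lexx 0) t_ge0).
  apply: (le_trans (esumZ_le _ _ _)) => //; first by rewrite mulr_ge0// sqr_ge0.
  have fin : (\esum_(e' in neighbours A e) (rate e')%:E)%E \is a fin_num.
    rewrite ge0_fin_numE ?esum_ge0//.
    apply: le_lt_trans (edges_at_rate_fin ((val e).1 |` ((val e).2 |` A))%fset).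
    rewrite esum_mkcond [leRHS]esum_mkcond; apply: le_esum => e' _.
    case: ifPn => [/set_mem[_ h]|_]; last by case: ifP.
    by rewrite mem_set.
  by rewrite -{1}(fineK fin) -EFinM lee_fin mulrAC.
have mBB e : measurable (jumps_again e 0 t `|` B e).
  by apply: measurableU; [exact: measurable_jumps_again|case: (mB e)].
have [m1 h1] := measure_bigcup_countable_le P [set` F] mBB.
split=> //; apply: (le_trans h1).
rewrite esum_fset//.
rewrite fsbig_finite//= set_fsetK /double_rate mulr_suml -sumEFin.
apply: lee_sum => e _.
have mja : measurable (jumps_again e 0 t : set (borel (path_family R S))).
  exact: measurable_jumps_again.
apply: (le_trans (measureU2 P mja (mB e).1)).
rewrite mulrDl EFinD; apply: leeD; last by case: (mB e).
have := jumps_again_prob_le hc hP e (lexx 0) t_ge0; by rewrite subr0 exprMn.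
Qed.

End rare_events.

(** * The semigroup at small times *)

Section semigroup_derivative.
Variables (R : realType) (S : countType).
Variables (c : S -> S -> R) (P : probability (borel (path_family R S)) R) (t0 : R).
Hypotheses (hc : forall x y, 0 <= c x y) (hc0 : forall x, c x x = 0).
Hypotheses (hP : poisson_law c P) (hSEP : assumption_SEP P t0).
Implicit Types (f : config S -> R) (sigma : config S) (A : {fset S}) (e : oedge S)
  (F : {fset oedge S}) (t : R).

Let rate := rate c.

Definition exclusion_generator f sigma : R :=
  series_sum (fun x => series_sum (fun y => generator_term c f x y sigma)).

Lemma expR_sub_le (m : R) : 0 <= m -> `|1 - expR (- m) - m| <= m ^+ 2.
Proof.
move=> m0; have h1 := expR_ge1Dx (- m).
have h2 : expR (- m) <= 1 - m + m ^+ 2.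
  have e0 := expR_gt0 m; have e1 := expR_ge1Dx m.
  rewrite expRN -[leLHS]mul1r ler_pdivrMr//.
  apply: (@le_trans _ _ ((1 - m + m ^+ 2) * (1 + m))).
    by have := exprn_ge0 3 m0; rewrite !exprS expr0; nra.
  by rewrite ler_wpM2l//; have := sqr_ge0 (m - 1); rewrite !expr2; nra.
by rewrite ler_norml; apply/andP; split; have := sqr_ge0 m; lra.
Qed.

Lemma norm_chain (a b d s l w e1 e2 e3 e4 : R) : `|a - b| <= e1 ->
  `|b - (d + s)| <= e2 -> `|s - w| <= e3 -> `|l - w| <= e4 ->
  `|a - d - l| <= e1 + e2 + e3 + e4.
Proof.
rewrite !ler_norml => /andP[? ?] /andP[? ?] /andP[? ?] /andP[? ?].
by apply/andP; split; lra.
Qed.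

(** A bound uniform in [sigma]: the generator is a uniform limit of finite sums of local
    functions. *)
Lemma exclusion_generator_approx A f M F sigma : supported_on A f -> 0 <= M ->
  (forall xi, `|f xi| <= M) ->
  `|exclusion_generator f sigma - \sum_(e <- F) rate e * gain f sigma e| <=
  2 * M * fine (\esum_(e in edges_at A `\` [set` F]) (rate e)%:E).
Proof.
move=> fA M0 fM.
have b0 p : (0 <= (term_bound c A M p)%:E)%E by rewrite lee_fin term_bound_ge0.
have r0 e : (0 <= (rate e)%:E)%E by rewrite lee_fin /rate rate_ge0.
have efin F' : (\esum_(e in edges_at A `\` [set` F']) (rate e)%:E)%E \is a fin_num.
  rewrite ge0_fin_numE ?esum_ge0//; apply: le_lt_trans (edges_at_rate_fin hc hP hSEP A).
  rewrite esum_mkcond [leRHS]esum_mkcond; apply: le_esum => e _.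
  by case: ifPn => [/set_mem[h _]|_]; [rewrite mem_set|case: ifP].
have tail F' := term_bound_tail hc hc0 A F' M0.
have bfin : (\esum_(p in [set: S * S]) (term_bound c A M (p.1, p.2))%:E < +oo)%E.
  have := tail fset0; rewrite (_ : ~` _ = setT); last first.
    by apply/seteqP; split=> p //= _ /imfsetP[e]; rewrite inE.
  move=> h; rewrite (eq_esum (b := fun p => (term_bound c A M p)%:E)); last by case.
  by apply: (le_lt_trans h); rewrite -(fineK (efin _)) -EFinM ltry.
have := iterated_series_sum (b := fun x y => term_bound c A M (x, y)) (val @` F)%fset
  (fun x y => generator_term_le hc x y sigma fA fM) bfin.
rewrite big_imfset/=; last by move=> e e' _ _ /val_inj.
rewrite (eq_bigr (fun e => rate e * gain f sigma e)); last by move=> e _; rewrite rate_gain.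
move/le_trans; apply.
have pairE : (\esum_(p in ~` [set` (val @` F)%fset]) (term_bound c A M (p.1, p.2))%:E =
    \esum_(p in ~` [set` (val @` F)%fset]) (term_bound c A M p)%:E)%E.
  by apply: eq_esum => -[].
have tailF : (\esum_(p in ~` [set` (val @` F)%fset]) (term_bound c A M (p.1, p.2))%:E <=
    (2 * M * fine (\esum_(e in edges_at A `\` [set` F]) (rate e)%:E))%:E)%E.
  by rewrite pairE EFinM (fineK (efin F)); exact: tail.
rewrite -lee_fin fineK//.
rewrite ge0_fin_numE; last by apply: esum_ge0.
by apply: (le_lt_trans tailF); rewrite ltry.
Qed.

(** Before time [t], an edge [e] of [F] jumps with probability [rate e * t] up to an error
    of order [t ^ 2]; one of the other edges that meet [A] jumps with probability at most
    [eps * t]; and interfering jumps occur with probability of order [t ^ 2]. The constant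
    [C] depends on [F], hence on [eps], but not on [sigma]. *)
Lemma semigroup_estimate A f M F (eps : R) : supported_on A f -> 0 <= M ->
  (forall xi, `|f xi| <= M) -> [set` F] `<=` edges_at A ->
  (\esum_(e in edges_at A `\` [set` F]) (rate e)%:E <= eps%:E)%E ->
  exists2 C, 0 <= C & forall t sigma, 0 < t < t0 ->
  `|semigroup P t0 t f sigma - f sigma - t * exclusion_generator f sigma| <=
    t * (4 * M * eps) + C * t ^+ 2.
Proof.
move=> fA M0 fM FA Feps.
set T := path_family R S.
have r0 e : 0 <= rate e by rewrite /rate rate_ge0.
have [N [mN PN NK]] : P.-negligible (~` [set K : borel T | regular K /\ Gamma_star t0 K]).
  have h1 : {ae P, forall K : borel T, regular K} := regular_ae hP.
  have h2 : {ae P, forall K : borel T, Gamma_star t0 K} := Gamma_star_ae hc hP hSEP.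
  exact: (ae_imply2 h1 h2 (fun K => @conj _ _)).
pose D := double_rate c A F.
have D0 : 0 <= D by exact: double_rate_ge0.
pose M' := M + \sum_(e <- F) 2 * M.
have gainM sigma e : `|gain f sigma e| <= 2 * M.
  by rewrite (le_trans (ler_normB _ _))// mulrDl !mul1r lerD.
have MM' : M <= M' by rewrite lerDl sumr_ge0// => e _; rewrite mulr_ge0.
pose Q := \sum_(e <- F) rate e ^+ 2.
have Q0 : 0 <= Q by apply: sumr_ge0 => e _; exact: sqr_ge0.
exists (2 * M * D + 2 * M' * D + 2 * M * Q).
  by rewrite !addr_ge0// mulr_ge0// mulr_ge0// (le_trans M0).
move=> t sigma /andP[t_gt0 tt0]; have t_ge0 := ltW t_gt0.
have [mfar Pfar] := far_jump_prob hc hP A F t_ge0.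
have [mdbl Pdbl] := double_jump_prob hc hP hSEP A F t_ge0.
pose h : borel T -> R := first_order f sigma F t.
(* [h] is bounded by [M'] only, which grows with the size of [F], while [psi] is bounded
   by [M]: the event of probability [t * eps] is thus charged with the factor [M], and
   [M'] only appears with the event of probability of order [t ^ 2]. *)
pose psi (K : borel T) := if `[< double_jump A F t K >] then f sigma else h K.
have psiM K : `|psi K| <= M.
  rewrite /psi /h; case: asboolP => // nd.
  by have [[_ ->]|[e [_ _ _ ->]]] := first_order_cases f sigma FA nd.
have hM K : `|h K| <= M'.
  rewrite /h /first_order (le_trans (ler_normD _ _))// lerD//.
  rewrite (le_trans (ler_norm_sum _ _ _))// ler_sum// => e _.
  rewrite normrM -[leRHS]mulr1 ler_pM//.
  by rewrite indicE; case: (_ \in _); rewrite ?normr0 ?normr1.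
pose E := far_jump A F t `|` (double_jump A F t `|` N).
have mE : measurable E by apply: measurableU => //; exact: measurableU.
have PE : fine (P E) <= t * eps + D * t ^+ 2.
  rewrite -lee_fin fineK ?fin_num_measure//.
  apply: (le_trans (measureU2 P mfar (measurableU _ _ mdbl mN))).
  rewrite EFinD; apply: leeD.
    by apply: (le_trans Pfar); rewrite EFinM; apply: lee_wpmul2l.
  apply: (le_trans (measureU2 P mdbl mN)).
  by rewrite -[leRHS]adde0; apply: leeD => //; rewrite le_eqVlt; apply/orP; left; apply/eqP.
have Pd : fine (P (double_jump A F t)) <= D * t ^+ 2.
  by rewrite -lee_fin fineK ?fin_num_measure.
have s1 : `|semigroup P t0 t f sigma - Rintegral P setT psi| <= 2 * M * (t * eps + D * t ^+ 2).
  have := @Rintegral_perturb _ _ _ P (Gamma_star t0) E (fun K => f (eta t0 K sigma t)) psi M mE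
    (fun K => fM _) psiM _.
  move=> /(_ _)/le_trans; apply; last by rewrite ler_wpM2l// mulr_ge0.
  move=> K /not_orP[nfar /not_orP[nd nN]].
  have [Kr KG] : regular K /\ Gamma_star t0 K by apply: contrapT => nK; apply: nN; exact: NK.
  split=> //; rewrite /psi asboolF//.
  by apply: one_jump_expansion nfar nd => //; rewrite t_ge0.
have s2 : `|Rintegral P setT psi - Rintegral P setT h| <= 2 * M' * (D * t ^+ 2).
  have := @Rintegral_perturb _ _ _ P setT (double_jump A F t) psi h M' mdbl
    (fun K => le_trans (psiM K) MM') hM _.
  move=> /(_ _)/le_trans; apply; last by rewrite ler_wpM2l// mulr_ge0// (le_trans M0).
  by move=> K nd; split=> //; rewrite /psi asboolF.
have s3 : Rintegral P setT h = f sigma +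
    \sum_(e <- F) gain f sigma e * (1 - expR (- (rate e * t))).
  rewrite /h /first_order Rintegral_indic_comb; last by move=> e; exact: measurable_jumps.
  congr (_ + _); apply: eq_bigr => e _; congr (_ * _).
  by rewrite (jumps_prob hc hP e (lexx 0) t_ge0) subr0.
have s4 : `|\sum_(e <- F) gain f sigma e * (1 - expR (- (rate e * t))) -
    t * \sum_(e <- F) rate e * gain f sigma e| <= 2 * M * Q * t ^+ 2.
  rewrite mulr_sumr -sumrB (le_trans (ler_norm_sum _ _ _))//.
  rewrite -mulrA mulr_suml mulr_sumr ler_sum// => e _.
  rewrite (_ : _ - _ = gain f sigma e * (1 - expR (- (rate e * t)) - rate e * t)); last by ring.
  rewrite normrM ler_pM// -exprMn.
  by apply: expR_sub_le; rewrite mulr_ge0.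
have s5 : `|t * exclusion_generator f sigma - t * \sum_(e <- F) rate e * gain f sigma e| <=
    t * (2 * M * eps).
  rewrite -mulrBr normrM (gtr0_norm t_gt0) ler_wpM2l//.
  apply: (le_trans (exclusion_generator_approx F sigma fA M0 fM)).
  rewrite ler_wpM2l ?mulr_ge0// -lee_fin fineK//.
  rewrite ge0_fin_numE; last by apply: esum_ge0 => e _; rewrite lee_fin.
  by rewrite (le_lt_trans Feps)// ltry.
rewrite s3 in s2; apply: le_trans (norm_chain s1 s2 s4 s5) _.
by rewrite le_eqVlt; apply/orP; left; apply/eqP; ring.
Qed.

End semigroup_derivative.

(** * The generator on local functions *)

Section generator_of_local_functions.
Variables (R : realType) (S : countType).
Variables (c : S -> S -> R) (P : probability (borel (path_family R S)) R) (t0 : R).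
Hypotheses (hc : forall x y, 0 <= c x y) (hc0 : forall x, c x x = 0).
Hypotheses (hP : poisson_law c P) (hSEP : assumption_SEP P t0).
Implicit Types (f g : config S -> R) (sigma : config S) (A : {fset S}).

Lemma edges_at_tail A (eps : R) : 0 < eps -> exists F : {fset oedge S},
  [set` F] `<=` edges_at A /\
  (\esum_(e in edges_at A `\` [set` F]) (rate c e)%:E <= eps%:E)%E.
Proof.
move=> eps0; apply: esum_tail => //; last exact: (edges_at_rate_fin hc hP hSEP).
by move=> e _; rewrite lee_fin /rate.
Qed.

Lemma continuous_exclusion_generator f : local_function f ->
  continuous (exclusion_generator c f).
Proof.
move=> flocal; have [A fA] := flocal; have [M M0 fM] := bounded_local flocal.
have K0 : 0 < 4 * M + 1 by rewrite ltr_wpDl// mulr_ge0.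
move=> xi; apply/cvgrPdist_le => eps eps0.
have [F [FA Feps]] := edges_at_tail A (divr_gt0 eps0 K0).
pose B := (A `|` ([fset (val e).1 | e in F] `|` [fset (val e).2 | e in F]))%fset.
have near_xi := near_agree B xi.
apply: (@filterS _ (nbhs xi) (nbhs_filter xi) _ _ _ near_xi) => zeta H.
have sumE : \sum_(e <- F) rate c e * gain f xi e = \sum_(e <- F) rate c e * gain f zeta e.
  rewrite big_seq [RHS]big_seq; apply: eq_bigr => e eF; rewrite !rate_gain.
  apply: (generator_term_supported c fA) => z; rewrite !inE => zB.
  apply: H; rewrite !inE; case/or3P: zB => [/eqP->|/eqP->|->//].
  - by apply/or3P; apply: Or32; apply/imfsetP; exists e.
  - by apply/or3P; apply: Or33; apply/imfsetP; exists e.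
have tail_le : 2 * M * fine (\esum_(e in edges_at A `\` [set` F]) (rate c e)%:E) <= eps / 2.
  have fin_le : fine (\esum_(e in edges_at A `\` [set` F]) (rate c e)%:E) <= eps / (4 * M + 1).
    rewrite -lee_fin fineK// ge0_fin_numE; last by apply: esum_ge0 => e _; rewrite lee_fin /rate.
    by rewrite (le_lt_trans Feps)// ltry.
  apply: (@le_trans _ _ (2 * M * (eps / (4 * M + 1)))); first by rewrite ler_wpM2l// mulr_ge0.
  by rewrite mulrA ler_pdivrMr//; nra.
have := exclusion_generator_approx hc hc0 hP hSEP F xi fA M0 fM.
have := exclusion_generator_approx hc hc0 hP hSEP F zeta fA M0 fM.
move=> /le_trans/(_ tail_le); rewrite -sumE ler_norml => /andP[? ?].
move=> /le_trans/(_ tail_le); rewrite ler_norml => /andP[? ?].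
by rewrite ler_norml; apply/andP; split; lra.
Qed.

Lemma uniform_norm_le f (b : R) : (forall xi, `|f xi| <= b) -> (uniform_norm f <= b%:E)%E.
Proof. by move=> fb; apply: ge_ereal_sup => _ [xi _ <-]; rewrite lee_fin. Qed.

Lemma norm_le_uniform_norm f xi : (`|f xi|%:E <= uniform_norm f)%E.
Proof. by apply: ereal_sup_ubound; exists xi. Qed.

Lemma uniform_difference_quotient f (eps : R) : local_function f -> 0 < eps ->
  \forall t \near 0^'+, forall sigma,
    `|(semigroup P t0 t f sigma - f sigma) / t - exclusion_generator c f sigma| <= eps.
Proof.
move=> flocal eps0; have [A fA] := flocal; have [M M0 fM] := bounded_local flocal.
have K0 : 0 < 8 * M + 1 by rewrite ltr_wpDl// mulr_ge0.
have [F [FA Feps]] := edges_at_tail A (divr_gt0 eps0 K0).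
have [C C0 HC] := semigroup_estimate hc hc0 hP hSEP fA M0 fM FA Feps.
have t0_gt0 : 0 < t0 by have [] := hSEP.
have C2 : 0 < 2 * C + 1 by rewrite ltr_wpDl// mulr_ge0.
have d0 : 0 < Num.min t0 (eps / (2 * C + 1)) by rewrite lt_min t0_gt0 divr_gt0.
near=> t => sigma.
have t_gt0 : 0 < t by [].
have : t < Num.min t0 (eps / (2 * C + 1)) by near: t; exact: nbhs_right_lt.
rewrite lt_min => /andP[tt0 tC].
have := HC t sigma; rewrite t_gt0 tt0 => /(_ isT) H.
rewrite -(ler_pM2l t_gt0) -[X in X * `|_|](gtr0_norm t_gt0) -normrM.
rewrite mulrBr mulrCA divff ?gt_eqF// mulr1.
apply: (le_trans H).
have h1 : 4 * M * (eps / (8 * M + 1)) <= eps / 2 by rewrite mulrA ler_pdivrMr//; nra.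
have h2 : C * t <= eps / 2.
  by move: tC; rewrite ltr_pdivlMr// => tC; nra.
rewrite expr2 [C * _]mulrCA -mulrDr ler_wpM2l ?(ltW t_gt0)//; lra.
Unshelve. all: by end_near. Qed.

Lemma generator_graph_local f : local_function f ->
  generator_graph P t0 f (exclusion_generator c f).
Proof.
move=> flocal; split; [exact: continuous_local|exact: continuous_exclusion_generator|].
have near_le (eps : R) : 0 < eps -> \forall t \near 0^'+,
    (0 <= uniform_norm (fun sigma => ((semigroup P t0 t f sigma - f sigma) / t -
      exclusion_generator c f sigma)%R) <= eps%:E)%E.
  move=> eps0; apply: filterS (uniform_difference_quotient flocal eps0) => t H.
  rewrite uniform_norm_le// andbT.
  by apply: le_trans (norm_le_uniform_norm _ (fun=> false)); rewrite lee_fin.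
apply/fine_cvgP; split.
  apply: filterS (near_le 1 ltr01) => t /andP[h0 h1].
  by rewrite ge0_fin_numE// (le_lt_trans h1)// ltry.
apply/cvgrPdist_le => eps eps0; apply: filterS (near_le eps eps0) => t /andP[h0 h1].
rewrite sub0r normrN /= ger0_norm ?fine_ge0// -lee_fin fineK//.
by rewrite ge0_fin_numE// (le_lt_trans h1)// ltry.
Qed.

Lemma generator_graph_unique f g g' : generator_graph P t0 f g ->
  generator_graph P t0 f g' -> g = g'.
Proof.
move=> [_ _ hg] [_ _ hg']; apply/funext => sigma.
have lim_at (k : config S -> R) :
    (fun t => uniform_norm (fun sigma => (semigroup P t0 t f sigma - f sigma) / t - k sigma))
      @ 0^'+ --> 0%E ->
    (fun t => (semigroup P t0 t f sigma - f sigma) / t) @ 0^'+ --> k sigma.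
  move=> /fine_cvgP[fin /cvgrPdist_le hk]; apply/cvgrPdist_le => eps eps0.
  have := hk eps eps0; apply: filterS2 fin => t fint ht.
  rewrite distrC; move: ht; rewrite sub0r normrN /=; apply: le_trans.
  rewrite -lee_fin.
  have := norm_le_uniform_norm (fun sigma => (semigroup P t0 t f sigma - f sigma) / t - k sigma) sigma.
  move=> /le_trans; apply.
  by rewrite -{1}(fineK fint) lee_fin ler_norm.
have hd : hausdorff_space R by exact: norm_hausdorff.
by rewrite -(cvg_lim hd (lim_at g hg)) -(cvg_lim hd (lim_at g' hg')).
Qed.

End generator_of_local_functions.

Theorem proposition5p11 (R : realType) (S : countType)
    (c : S -> S -> R) (P : probability (borel (path_family R S)) R) (t0 : R)
    (hS : infinite_set [set: S])
    (hc : forall x y, 0 <= c x y) (hc0 : forall x, c x x = 0)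
    (hP : poisson_law c P) (hSEP : assumption_SEP P t0) :
  forall f : config S -> R, local_function f ->
    [/\ generator_domain P t0 f,
        forall xi : config S, generator P t0 f xi =
          series_sum (fun x => series_sum (fun y => generator_term c f x y xi)),
        forall x y, continuous (generator_term c f x y)
      & (\esum_(p in [set: S * S])
           uniform_norm (generator_term c f p.1 p.2) < +oo)%E].
Proof.
move=> f flocal; have fgraph := generator_graph_local hc hc0 hP hSEP flocal.
have [A fA] := flocal; have [M M0 fM] := bounded_local flocal.
split.
- by exists (exclusion_generator c f).
- move=> xi; rewrite /generator.
  rewrite (@xget_unique _ (cst 0) (generator_graph P t0 f) (exclusion_generator c f))//.
  by move=> g fg; exact: generator_graph_unique fg fgraph.
- move=> x y; apply: continuous_local; exists (x |` (y |` A))%fset.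
  exact: generator_term_supported.
- apply: (@le_lt_trans _ _ (\esum_(p in [set: S * S]) (term_bound c A M p)%:E)%E).
    apply: le_esum => -[x y] _; apply: uniform_norm_le => xi.
    exact: generator_term_le.
  have := term_bound_tail hc hc0 A fset0 M0.
  rewrite (_ : ~` _ = setT); last by apply/seteqP; split=> p //= _ /imfsetP[e]; rewrite inE.
  rewrite (_ : _ `\` _ = edges_at A); last by apply/seteqP; split=> [e []//|e eA]; split.
  move/le_lt_trans; apply.
  have fin : (\esum_(e in edges_at A) (rate c e)%:E)%E \is a fin_num.
    rewrite ge0_fin_numE; first exact: (edges_at_rate_fin hc hP hSEP).
    by apply: esum_ge0 => e _; rewrite lee_fin /rate.
  by rewrite -(fineK fin) -EFinM ltry.
Qed.
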